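(* Assume the Continuum Hypothesis. Then $FCA^\Delta$ holds: for every good type $\tau$ there exists a fully $\Delta$-capturing construction scheme of type $\tau$ over $\omega_1$.
   Context: A type is a sequence $\tau=\langle m_k,n_{k+1},r_{k+1}\rangle_{k\in\omega}$ of natural numbers with $m_0=1$ and, for all $k$, $n_{k+1}\geq2$, $m_k>r_{k+1}$, $m_{k+1}=r_{k+1}+(m_k-r_{k+1})n_{k+1}$. It is good if for every $r\in\omega$ there are infinitely many $k\geq1$ with $r_k=r$. For sets of ordinals, $A<B$ means every element of $A$ is below every element of $B$; for a finite set $D$ of ordinals, $D(a)$ is its $a$-th element in increasing order. A construction scheme of type $\tau$ over a set of ordinals $Y$ is a family $\mathcal{F}$ of nonempty finite subsets of $Y$, cofinal under $\subseteq$ among finite subsets of $Y$, each member of size $m_k$ for some $k$, such that with $\mathcal{F}_k=\{F\in\mathcal{F}:|F|=m_k\}$: (i) for $E,F\in\mathcal{F}_k$, $E\cap F$ is an initial segment of both $E$ and $F$; (ii) every $F\in\mathcal{F}_{k+1}$ is $F_0\cup\dots\cup F_{n_{k+1}-1}$ with $F_i\in\mathcal{F}_k$ forming a $\Delta$-system with root $R(F)$, $|R(F)|=r_{k+1}$, and $R(F)<F_0\setminus R(F)<\dots<F_{n_{k+1}-1}\setminus R(F)$ (this decomposition is unique). Associated functions: $\rho(\alpha,\beta)=\min\{k:\exists F\in\mathcal{F}_k\ \{\alpha,\beta\}\subseteq F\}$; $(\alpha)_k=\{\xi\leq\alpha:\rho(\xi,\alpha)\leq k\}$, $(\alpha)^-_k=(\alpha)_k\setminus\{\alpha\}$,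 $\lVert\alpha\rVert_k=|(\alpha)^-_k|$; $\Delta(\alpha,\beta)=\min\{k:\lVert\alpha\rVert_k\neq\lVert\beta\rVert_k\}$ ($=\omega$ if none); for $k\geq1$ (with $m_k\leq|Y|$), $\Xi_\alpha(k)=-1$ if $\alpha\in R(F)$ and $\Xi_\alpha(k)=i$ if $\alpha\in F_i\setminus R(F)$, for any $F\in\mathcal{F}_k$ containing $\alpha$ (independent of the choice of $F$); $\Xi_\alpha(0)=0$. A root-tail-tail $\Delta$-system is a sequence $\langle D_i\rangle_{i<n}$, $n\geq2$, of finite sets of ordinals of common size $m$ with pairwise intersections equal to $R$, $R<D_i\setminus R$, and $D_0\setminus R<D_1\setminus R<\dots<D_{n-1}\setminus R$; let $r=|R|$. For $\nu\in\{\rho,\Delta\}$ and $l\geq1$, it is $\nu$-captured at level $l$ if $n\leq n_l$ and (I) for all $i<n$, $a<m$: $\Xi_{D_i(a)}(l)=-1$ if $a<r$ and $=i$ if $a\geq r$; (II) $\nu(D_i(a),D_j(a))=l$ for all $i<j<n$ and $r\leq a<m$. It is fully $\nu$-captured at level $l$ if moreover $n=n_l$. A scheme $\mathcal{F}$ over $\omega_1$ is fully $\nu$-capturing if for every uncountable family $\mathcal{S}$ of nonempty finite subsets of $\omega_1$ there are infinitely many $l$ for which some $n_l$ distinct members of $\mathcal{S}$, suitably enumerated, form a root-tail-tail $\Delta$-system fully $\nu$-captured at level $l$. *)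

(* Defs.v *)
(* omega_1 is modelled abstractly as any type T with a strict
   well-order lt of order type omega_1 (uncountable, all proper initial
   segments countable).  Finite sets of ordinals are strictly increasing lists. *)
From Stdlib Require Import List Arith Sorting.Sorted ZArith.
Import ListNotations.

Definition countable_pred {X : Type} (P : X -> Prop) : Prop :=
  exists f : X -> nat, forall x y, P x -> P y -> f x = f y -> x = y.

Definition is_omega1 {T : Type} (lt : T -> T -> Prop) : Prop :=
  (forall x, ~ lt x x) /\
  (forall x y z, lt x y -> lt y z -> lt x z) /\
  (forall x y, lt x y \/ x = y \/ lt y x) /\
  well_founded lt /\
  ~ countable_pred (fun _ : T => True) /\
  (forall a, countable_pred (fun x => lt x a)).

Definition CH (T : Type) : Prop :=
  exists f : T -> (nat -> bool),
    (forall x y, f x = f y -> x = y) /\ (forall g, exists x, f x = g).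

(* types tau = <m_k, n_{k+1}, r_{k+1}> ; n 0 and r 0 are irrelevant *)
Definition is_type (m n r : nat -> nat) : Prop :=
  m 0 = 1 /\
  forall k, 2 <= n (S k) /\ r (S k) < m k /\
            m (S k) = r (S k) + (m k - r (S k)) * n (S k).

Definition good_type (m n r : nat -> nat) : Prop :=
  is_type m n r /\
  forall r0 N, exists k, N <= k /\ 1 <= k /\ r k = r0.

Section SchemeDefs.
Context {T : Type} (lt : T -> T -> Prop).

(* a finite set of ordinals, listed in increasing order; D(a) = nth a D *)
Definition fset (l : list T) : Prop := Sorted lt l.

Definition set_lt (P Q : T -> Prop) : Prop :=
  forall a b, P a -> Q b -> lt a b.

Definition rtt_delta (k : nat) (D : nat -> list T) (R : list T) : Prop :=
  2 <= k /\
  (forall i, i < k -> fset (D i)) /\ fset R /\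
  (forall i, i < k -> length (D i) = length (D 0)) /\
  (forall i j, i < j < k -> forall x, (In x (D i) /\ In x (D j)) <-> In x R) /\
  (forall i, i < k -> set_lt (fun x => In x R) (fun x => In x (D i) /\ ~ In x R)) /\
  (forall i j, i < j < k ->
     set_lt (fun x => In x (D i) /\ ~ In x R) (fun x => In x (D j) /\ ~ In x R)).

Variables (m n r : nat -> nat) (fam : list T -> Prop).

(* decomposition of E in F_l (l >= 1) as F_0 u ... u F_{n_l - 1}, F_i in F_{l-1} *)
Definition decomp (E : list T) (l : nat) (Fs : nat -> list T) (R : list T) : Prop :=
  (forall i, i < n l -> fam (Fs i) /\ length (Fs i) = m (l - 1)) /\
  rtt_delta (n l) Fs R /\ length R = r l /\
  (forall x, In x E <-> exists i, i < n l /\ In x (Fs i)).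

Definition is_scheme : Prop :=
  (forall E, fam E -> E <> [] /\ fset E /\ exists k, length E = m k) /\
  (forall A : list T, exists E, fam E /\ forall x, In x A -> In x E) /\
  (forall k E F, fam E -> fam F -> length E = m k -> length F = m k ->
     forall x y, In x E -> In x F -> In y E -> lt y x -> In y F) /\
  (forall k E, fam E -> length E = m (S k) -> exists Fs R, decomp E (S k) Fs R).

Definition rho_le (x y : T) (k : nat) : Prop :=
  exists k', k' <= k /\ exists E, fam E /\ length E = m k' /\ In x E /\ In y E.

Definition rho_eq (x y : T) (l : nat) : Prop :=
  rho_le x y l /\ forall k, k < l -> ~ rho_le x y k.

Definition below (x : T) (k : nat) : T -> Prop :=
  fun xi => lt xi x /\ rho_le xi x k.

Definition card_is (P : T -> Prop) (c : nat) : Prop :=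
  exists l, NoDup l /\ (forall x, In x l <-> P x) /\ length l = c.

Definition norm_eq (x y : T) (k : nat) : Prop :=
  exists c, card_is (below x k) c /\ card_is (below y k) c.

Definition norm_neq (x y : T) (k : nat) : Prop :=
  exists c c', c <> c' /\ card_is (below x k) c /\ card_is (below y k) c'.

Definition Delta_eq (x y : T) (l : nat) : Prop :=
  (forall k, k < l -> norm_eq x y k) /\ norm_neq x y l.

Definition Xi_eq (x : T) (l : nat) (v : Z) : Prop :=
  exists E Fs R, fam E /\ length E = m l /\ In x E /\ decomp E l Fs R /\
    ((v = (-1)%Z /\ In x R) \/
     (exists i, v = Z.of_nat i /\ i < n l /\ In x (Fs i) /\ ~ In x R)).

(* <D_i>_{i<k} is nu-captured at level l (nu x y l means nu(x,y) = l) *)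
Definition captured (nu : T -> T -> nat -> Prop) (l k : nat)
    (D : nat -> list T) (R : list T) : Prop :=
  1 <= l /\ rtt_delta k D R /\ k <= n l /\
  (forall i a x, i < k -> nth_error (D i) a = Some x ->
     Xi_eq x l (if a <? length R then (-1)%Z else Z.of_nat i)) /\
  (forall i j a x y, i < j < k -> length R <= a ->
     nth_error (D i) a = Some x -> nth_error (D j) a = Some y -> nu x y l).

Definition fully_captured (nu : T -> T -> nat -> Prop) (l : nat)
    (D : nat -> list T) (R : list T) : Prop :=
  captured nu l (n l) D R.

Definition fully_capturing (nu : T -> T -> nat -> Prop) : Prop :=
  forall S : list T -> Prop,
    (forall A, S A -> A <> [] /\ fset A) ->
    ~ countable_pred S ->
    forall N, exists l, N <= l /\
      exists D R, (forall i, i < n l -> S (D i)) /\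
        (forall i j, i < j < n l -> D i <> D j) /\
        fully_captured nu l D R.

End SchemeDefs.

(* Main.v *)
Require Import Defs.
From Stdlib Require Import List Arith ZArith Lia Sorting.Sorted Classical ClassicalEpsilon
  FunctionalExtensionality Cantor.
Import ListNotations.

(** Write L x k for the set (x)_k in increasing order.  The scheme is built by recursion
    on x: a successor y+1 "rides" on y, i.e. L (y+1) k = L y k ++ [y+1] whenever there is
    room.  A limit x is described by a path of ordinals b_k < x with
    L x k = L b_k k ++ [x].  One may always ride (b_{k+1} = b_k), and when L b_k k has
    exactly r_{k+1} elements one may also jump: put x in any block i of a set of F_{k+1}
    with root L b_k k.  The path is chosen generically.

    By CH the sets of finite approximations (k, p), p a list of positions in members of
    F_k, are enumerated as A_t (t < omega_1).  At a limit x > t, whenever riding from now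
    on along the current b leaves A_t at some level, the path does so; and at a level
    where x may jump, it jumps out of A_t if some block allows it.
    Given an uncountable family with root R, let A_{t0} be the set of approximations
    realised by members with arbitrarily high tails.  A member with tail above a limit c0
    (c0 large enough) stays in A_{t0} forever.  By well-founded descent (a position that
    stays in A_{t0} along x also does so along some smaller ordinal >= c0) so does a list
    of positions riding along c0 itself.  At c0 and a level k where a jump is possible,
    R lies in the root and the tail outside it, so no block of level k+1 leaves A_{t0}:
    all of them are realised in A_{t0}, which is full capturing at level k+1. *)

(** * Coding of finite sequences, countability, recursion with choices *)

Fixpoint code (l : list nat) : nat :=
  match l with [] => 0 | a :: l => S (to_nat (a, code l)) end.

Lemma code_inj l l' : code l = code l' -> l = l'.
Proof.
  revert l'. induction l as [|a l IH]; intros [|a' l'] E; cbn [code] in E; try discriminate; auto.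
  apply eq_add_S in E. apply to_nat_inj in E. inversion E; subst. f_equal; auto.
Qed.

Lemma code_dec : exists dec, forall l, dec (code l) = l.
Proof.
  exists (fun c => epsilon (inhabits []) (fun l => code l = c)). intros l.
  apply code_inj. apply (epsilon_spec (inhabits []) (fun l' => code l' = code l)). eauto.
Qed.

Lemma countable_sub {X : Type} (P Q : X -> Prop) :
  (forall x, P x -> Q x) -> countable_pred Q -> countable_pred P.
Proof. intros H [f Hf]. exists f; auto. Qed.

Lemma countable_single {X : Type} (a : X) : countable_pred (fun x => x = a).
Proof. exists (fun _ => 0). intros; subst; auto. Qed.

Lemma countable_union {X I : Type} (J : I -> Prop) (P : I -> X -> Prop) : countable_pred J ->
  (forall i, J i -> countable_pred (P i)) -> countable_pred (fun x => exists i, J i /\ P i x).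
Proof.
  intros [h Hh] HP.
  assert (H1 : forall i, exists g : X -> nat, J i -> forall x y, P i x -> P i y -> g x = g y -> x = y).
  { intros i. destruct (classic (J i)) as [Ji|Ji]; [|exists (fun _ => 0); tauto].
    destruct (HP i Ji) as [g Hg]. exists g; auto. }
  apply choice in H1. destruct H1 as [g Hg].
  assert (H2 : forall x, exists c, (exists i, J i /\ P i x) ->
    exists i, J i /\ P i x /\ c = to_nat (h i, g i x)).
  { intros x. destruct (classic (exists i, J i /\ P i x)) as [(i & Ji & Hi)|H]; [|exists 0; tauto].
    exists (to_nat (h i, g i x)). eauto. }
  apply choice in H2. destruct H2 as [c Hc].
  exists c. intros x y Hx Hy E.
  destruct (Hc x Hx) as (i & Ji & Hi & Ei). destruct (Hc y Hy) as (j & Jj & Hj & Ej).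
  rewrite Ei, Ej in E. apply to_nat_inj in E. inversion E.
  assert (i = j) by auto. subst j. eapply Hg; eauto.
Qed.

Lemma countable_or {X : Type} (P Q : X -> Prop) :
  countable_pred P -> countable_pred Q -> countable_pred (fun x => P x \/ Q x).
Proof.
  intros HP HQ.
  apply (countable_sub _ (fun x => exists b : bool, True /\ (if b then P x else Q x))).
  - intros x [H|H]; [exists true|exists false]; auto.
  - apply countable_union.
    + exists (fun b : bool => if b then 0 else 1). intros [] []; auto; discriminate.
    + intros []; auto.
Qed.

(** At each x a value is picked by [epsilon] from the values below x, the others being replaced by
    [y0]; locality of [Q] makes this padding harmless. Each choice may presuppose that all earlier
    ones succeeded. *)
Lemma wf_choice {X Y : Type} (R : X -> X -> Prop) (y0 : Y) (Q : (X -> Y) -> X -> Y -> Prop) :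
  well_founded R ->
  (forall f g x e, (forall y, R y x -> f y = g y) -> Q f x e -> Q g x e) ->
  (forall f x, (forall y, R y x -> Q f y (f y)) -> exists e, Q f x e) ->
  exists f, forall x, Q f x (f x).
Proof.
  intros wf Hloc Hstep.
  set (res := fun x (rec : forall y, R y x -> Y) y =>
    match excluded_middle_informative (R y x) with left h => rec y h | right _ => y0 end).
  set (F := fun x rec => epsilon (inhabits y0) (Q (res x rec) x)).
  exists (Fix wf (fun _ => Y) F). set (f := Fix wf (fun _ => Y) F).
  assert (Hres : forall x y, R y x -> f y = res x (fun y _ => f y) y).
  { intros x y H. unfold res. destruct (excluded_middle_informative (R y x)); tauto. }
  intros x. induction x as [x IH] using (well_founded_ind wf).
  destruct (Hstep f x IH) as [e He].
  assert (E : f x = F x (fun y _ => f y)).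
  { unfold f at 1. rewrite Fix_eq; auto. intros z g h Hgh. f_equal.
    apply functional_extensionality_dep; intros y. apply functional_extensionality_dep; auto. }
  apply (Hloc (res x (fun y _ => f y))); [intros; symmetry; auto|].
  rewrite E. unfold F. apply epsilon_spec. exists e. eapply Hloc; eauto.
Qed.

Section Scheme.

Context {T : Type} (lt : T -> T -> Prop) (m n r : nat -> nat).
Hypothesis Homega1 : is_omega1 lt.
Hypothesis Hgood : good_type m n r.

Let lt_irr : forall x, ~ lt x x := proj1 Homega1.
Let lt_trans : forall x y z, lt x y -> lt y z -> lt x z := proj1 (proj2 Homega1).
Let lt_total : forall x y, lt x y \/ x = y \/ lt y x := proj1 (proj2 (proj2 Homega1)).
Let lt_wf : well_founded lt := proj1 (proj2 (proj2 (proj2 Homega1))).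

(** * Arithmetic of types *)

Lemma m_0 : m 0 = 1.
Proof. destruct Hgood as [[H _] _]; exact H. Qed.

Lemma n_ge2 k : 2 <= n (S k).
Proof. destruct Hgood as [[_ H] _]; destruct (H k) as (?&?&?); lia. Qed.

Lemma r_lt k : r (S k) < m k.
Proof. destruct Hgood as [[_ H] _]; destruct (H k) as (?&?&?); lia. Qed.

Definition width k := m k - r (S k).

Lemma width_pos k : 0 < width k.
Proof. pose proof (r_lt k); unfold width; lia. Qed.

Lemma m_width k : m k = r (S k) + width k.
Proof. pose proof (r_lt k); unfold width; lia. Qed.

Lemma m_S k : m (S k) = r (S k) + n (S k) * width k.
Proof.
  destruct Hgood as [[_ H] _]; destruct (H k) as (?&?&E); rewrite E.
  unfold width; lia.
Qed.

Lemma m_ltS k : m k < m (S k).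
Proof.
  rewrite m_S, (m_width k). pose proof (n_ge2 k). pose proof (width_pos k). nia.
Qed.

Lemma m_mono j k : j < k -> m j < m k.
Proof.
  induction 1; [apply m_ltS|]. pose proof (m_ltS m0). lia.
Qed.

Lemma m_inj j k : m j = m k -> j = k.
Proof.
  intros E. destruct (Nat.lt_trichotomy j k) as [H|[H|H]]; auto;
    apply m_mono in H; lia.
Qed.

Lemma r_inf q N : exists k, N <= k /\ r (S k) = q.
Proof.
  destruct Hgood as [_ H]. destruct (H q (S N)) as (k & H1 & H2 & H3).
  exists (k - 1). replace (S (k - 1)) with k by lia. split; auto; lia.
Qed.

(** * Positions inside a block decomposition *)

(* Of a prefix with [len] elements of a set of F_{k+1}, the last element lies in
   the block of index [idx k len] (0 if it lies in the root). *)
Definition idx k len := (len - 1 - r (S k)) / width k.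

(* Sends (x)_{k+1} to (x)_k. *)
Definition down k (l : list T) :=
  firstn (r (S k)) l ++ skipn (r (S k) + idx k (length l) * width k) l.

(* The position in a set of F_{k+1} of the a-th element of its i-th block. *)
Definition shift k i a := if a <? r (S k) then a else a + i * width k.

Lemma idx_small k len : len <= S (r (S k)) -> idx k len = 0.
Proof.
  intros H. unfold idx. replace (len - 1 - r (S k)) with 0 by lia.
  apply Nat.Div0.div_0_l.
Qed.

Lemma idx_eq k len i b : b < width k -> len = S (r (S k) + i * width k + b) -> idx k len = i.
Proof.
  intros H E. unfold idx. symmetry. apply (Nat.div_unique _ _ i b); lia.
Qed.

Lemma idx_cases k len : 0 < len ->
  len <= r (S k) \/
  exists b, b < width k /\ len = S (r (S k) + idx k len * width k + b).
Proof.
  intros H. destruct (le_lt_dec len (r (S k))) as [|H1]; [left; auto|right].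
  exists ((len - 1 - r (S k)) mod width k).
  pose proof (width_pos k).
  split; [apply Nat.mod_upper_bound; lia|].
  pose proof (Nat.div_mod_eq (len - 1 - r (S k)) (width k)).
  unfold idx. rewrite (Nat.mul_comm _ (width k)). lia.
Qed.

Lemma idx_lt k len : len <= m (S k) -> idx k len < n (S k).
Proof.
  intros H. pose proof (n_ge2 k). destruct len as [|len].
  - rewrite idx_small; lia.
  - destruct (idx_cases k (S len)) as [H1|(b & Hb & E)]; [lia| |].
    + rewrite idx_small; lia.
    + rewrite m_S in H. set (i := idx k (S len)) in *. nia.
Qed.

Lemma down_idx0 k l : idx k (length l) = 0 -> down k l = l.
Proof.
  intros H. unfold down. rewrite H. simpl. rewrite Nat.add_0_r. apply firstn_skipn.
Qed.

Lemma down_small k l : length l <= S (r (S k)) -> down k l = l.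
Proof. intros H. apply down_idx0, idx_small, H. Qed.

Lemma length_down k l :
  length (down k l) = Nat.min (r (S k)) (length l) + (length l - (r (S k) + idx k (length l) * width k)).
Proof. unfold down. rewrite length_app, length_firstn, length_skipn. lia. Qed.

Lemma length_down_cases k l : 0 < length l ->
  (length l <= r (S k) /\ down k l = l) \/
  exists b, b < width k /\ length l = S (r (S k) + idx k (length l) * width k + b)
    /\ length (down k l) = S (r (S k) + b).
Proof.
  intros H. destruct (idx_cases k (length l) H) as [H1|(b & Hb & E)].
  - left; split; [auto|apply down_small; lia].
  - right. exists b. split; [auto|split;[auto|]]. rewrite length_down.
    set (i := idx k (length l)) in *. lia.
Qed.

(** If the last element lay in a block, [down] would keep it together with the whole root, which
    gives more than r_{k+1} elements. *)
Lemma down_root k l : length (down k l) <= r (S k) -> down k l = l.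
Proof.
  intros H. destruct l as [|a l]; [apply down_small; simpl; lia|].
  destruct (length_down_cases k (a :: l)) as [[_ E]|(b & Hb & E1 & E2)]; [simpl; lia| |]; auto; lia.
Qed.

Lemma length_down_le k l : length (down k l) <= m k.
Proof.
  destruct l as [|a l].
  - rewrite down_small; simpl; lia.
  - pose proof (m_width k).
    destruct (length_down_cases k (a :: l)) as [[H1 ->]|(b & Hb & E1 & E2)]; [simpl; lia| |]; lia.
Qed.

Lemma length_down_shift k l : 0 < length l ->
  length l - 1 = shift k (idx k (length l)) (length (down k l) - 1).
Proof.
  intros H. unfold shift.
  destruct (length_down_cases k l H) as [[H1 ->]|(b & Hb & E1 & E2)].
  - destruct (Nat.ltb_spec (length l - 1) (r (S k))); [auto|lia].
  - rewrite E2. destruct (Nat.ltb_spec (S (r (S k) + b) - 1) (r (S k))); [lia|].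
    rewrite E1 at 1. lia.
Qed.

Lemma down_incl k l : incl (down k l) l.
Proof.
  intros x H. unfold down in H. apply in_app_or in H.
  destruct H as [H|H].
  - rewrite <- (firstn_skipn (r (S k)) l). apply in_or_app; auto.
  - rewrite <- (firstn_skipn (r (S k) + idx k (length l) * width k) l). apply in_or_app; auto.
Qed.

Lemma down_sorted k l : StronglySorted lt l -> StronglySorted lt (down k l).
Proof.
  intros H. unfold down. set (a := r (S k)). set (i := idx _ _ * _). clearbody a i.
  revert l H. induction a as [|a IH]; intros l H.
  - simpl. revert i l H. induction i; intros [|x l] H; simpl; auto. inversion H; auto.
  - destruct l as [|x l]; simpl; auto. inversion H; subst. constructor; auto.
    rewrite Forall_forall in *. intros y Hy. apply H3.
    apply in_app_or in Hy. destruct Hy as [Hy|Hy].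
    + rewrite <- (firstn_skipn a l). apply in_or_app; auto.
    + rewrite <- (firstn_skipn (a + i) l). apply in_or_app; auto.
Qed.

Lemma down_last k s x : exists s', down k (s ++ [x]) = s' ++ [x].
Proof.
  assert (Hp : 0 < length (s ++ [x])) by (rewrite length_app; simpl; lia).
  destruct (length_down_cases k (s ++ [x]) Hp) as [[_ E]|(b & Hb & E1 & E2)].
  - exists s; auto.
  - unfold down. set (i := idx _ _) in *. rewrite length_app in E1; simpl in E1.
    rewrite (skipn_app _ s).
    replace (r (S k) + i * width k - length s) with 0 by lia. simpl.
    rewrite app_assoc. eauto.
Qed.

(** The first hypothesis says that the last element of [p] survives. It then lies in the root or in
    the block where [p ++ tl] ends, so [down] deletes the same elements of [p] in both lists. This
    is how coherence descends one level. *)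
Lemma down_app k p tl :
  (exists y, In y p /\ ~ In y (removelast p) /\ In y (down k (p ++ tl))) ->
  NoDup (p ++ tl) ->
  (exists tl', down k (p ++ tl) = down k p ++ tl') /\
  (length p <= r (S k) \/ idx k (length p) = idx k (length (p ++ tl))).
Proof.
  intros (y & Hy & Hny & Hd) Hnd.
  destruct (exists_last (l := p)) as (p' & y' & ->); [intros ->; destruct Hy|].
  rewrite removelast_last in Hny.
  assert (y' = y) as ->.
  { apply in_app_or in Hy. destruct Hy as [|[|[]]]; [contradiction|auto]. }
  clear Hy Hny.
  assert (Hlp : length (p' ++ [y]) = S (length p')) by (rewrite length_app; simpl; lia).
  destruct (le_lt_dec (S (length p')) (r (S k))) as [H1|H1].
  - rewrite (down_small k (p' ++ [y])) by lia. split; [|left; lia].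
    unfold down. rewrite firstn_app.
    rewrite firstn_all2 by lia. rewrite <- (app_assoc (p' ++ [y])). eauto.
  - set (i := idx k (length ((p' ++ [y]) ++ tl))).
    (* The last element of [p] survives, so it is not in the deleted stretch between the root and
       block i. *)
    assert (H2 : r (S k) + i * width k <= length p').
    { destruct (le_lt_dec (r (S k) + i * width k) (length p')) as [|H2]; auto. exfalso.
      unfold down in Hd. fold i in Hd.
      assert (Hq : length p' < r (S k) \/ r (S k) <= length p') by lia.
      destruct Hq as [Hq|Hq]; [lia|].
      rewrite <- app_assoc in Hnd. simpl in Hnd. apply NoDup_remove_2 in Hnd.
      apply Hnd. apply in_app_or in Hd. apply in_or_app. destruct Hd as [Hd|Hd].
      - left. rewrite firstn_app in Hd.
        replace (r (S k) - length (p' ++ [y])) with 0 in Hd by lia. simpl in Hd.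
        rewrite app_nil_r, firstn_app in Hd. replace (r (S k) - length p') with 0 in Hd by lia.
        simpl in Hd. rewrite app_nil_r in Hd.
        rewrite <- (firstn_skipn (r (S k)) p'). apply in_or_app; auto.
      - right. rewrite skipn_app in Hd. rewrite (skipn_all2 (p' ++ [y])) in Hd by lia.
        simpl in Hd.
        rewrite <- (firstn_skipn (r (S k) + i * width k - length (p' ++ [y])) tl).
        apply in_or_app; auto. }
    assert (Hi : idx k (length (p' ++ [y])) = i).
    { destruct (idx_cases k (length ((p' ++ [y]) ++ tl))) as [H3|(b & Hb & E)].
      - rewrite length_app; lia.
      - rewrite length_app in H3; lia.
      - fold i in E. apply (idx_eq k _ i (length p' - r (S k) - i * width k)); [|lia].
        rewrite length_app in E. lia. }
    split; [|right; auto].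
    exists tl. unfold down. fold i. rewrite Hi.
    rewrite firstn_app. replace (r (S k) - length (p' ++ [y])) with 0 by lia. simpl.
    rewrite app_nil_r, <- (app_assoc (firstn _ _)). f_equal.
    rewrite (skipn_app _ (p' ++ [y]) tl).
    replace (r (S k) + i * width k - length (p' ++ [y])) with 0 by lia. auto.
Qed.

(* Appending x to L b (k+1) puts x in the same block as b: x rides on b. *)
Lemma down_ride k l x : l <> [] -> length l <= m (S k) -> length (down k l) < m k ->
  down k (l ++ [x]) = down k l ++ [x] /\ idx k (S (length l)) = idx k (length l)
  /\ S (length l) <= m (S k).
Proof.
  intros Hl H1 H2.
  assert (Hp : 0 < length l) by (destruct l; simpl; [congruence|lia]).
  pose proof (m_width k). pose proof (m_S k). pose proof (width_pos k).
  pose proof (m_ltS k). pose proof (idx_lt k _ H1).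
  assert (E : length (l ++ [x]) = S (length l)) by (rewrite length_app; simpl; lia).
  destruct (length_down_cases k l Hp) as [[Hs E1]|(b & Hb & E1 & E2)].
  - rewrite E1. rewrite (down_small k (l ++ [x])) by lia.
    rewrite !idx_small by lia. repeat split; lia.
  - set (i := idx k (length l)) in *.
    assert (Hi : idx k (S (length l)) = i) by (apply (idx_eq k _ i (S b)); lia).
    repeat split; [|auto|nia].
    unfold down. rewrite E, Hi. fold i. rewrite firstn_app, skipn_app.
    replace (r (S k) - length l) with 0 by lia.
    replace (r (S k) + i * width k - length l) with 0 by lia. simpl.
    rewrite app_nil_r, app_assoc. auto.
Qed.

(* Appending x after the end of block [i - 1] makes it the first element of block [i]. *)
Lemma down_jump k l x i : length l = r (S k) + i * width k ->
  down k (l ++ [x]) = firstn (r (S k)) l ++ [x] /\ idx k (S (length l)) = i.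
Proof.
  intros H. pose proof (width_pos k).
  assert (E : length (l ++ [x]) = S (length l)) by (rewrite length_app; simpl; lia).
  assert (Hi : idx k (S (length l)) = i) by (apply (idx_eq k _ i 0); lia).
  split; auto. unfold down. rewrite E, Hi, <- H.
  rewrite skipn_app, skipn_all, Nat.sub_diag. simpl.
  rewrite firstn_app. replace (r (S k) - length l) with 0 by lia. simpl. rewrite app_nil_r. auto.
Qed.

(* Positions at level [l + j] of elements with positions [p] at level [l] that lie in
   block [i k] of a set of F_{k+1}, or in its root, for each k from [l] on. *)
Fixpoint ev (i : nat -> nat) (l : nat) (p : list nat) (j : nat) : list nat :=
  match j with
  | 0 => p
  | S j => map (shift (l + j) (i (l + j))) (ev i l p j)
  end.

Definition stay (A : nat -> list nat -> Prop) i l p := forall j, A (l + j) (ev i l p j).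

Lemma ev_add i l p a b : ev i l p (a + b) = ev i (l + a) (ev i l p a) b.
Proof.
  induction b as [|b IH]; [rewrite Nat.add_0_r; auto|].
  rewrite Nat.add_succ_r. simpl. rewrite IH, Nat.add_assoc. auto.
Qed.

Lemma ev_ext i i' l p j : (forall k, l <= k < l + j -> i k = i' k) -> ev i l p j = ev i' l p j.
Proof.
  induction j as [|j IH]; simpl; auto. intros H. rewrite IH, H; auto; intros; [|apply H]; lia.
Qed.

Lemma stay_shift A i l p j : stay A i l p -> stay A i (l + j) (ev i l p j).
Proof. intros H a. rewrite <- ev_add, <- Nat.add_assoc. apply H. Qed.

Lemma stay_ext A i i' l p : (forall k, l <= k -> i k = i' k) -> stay A i l p -> stay A i' l p.
Proof. intros H S j. rewrite <- (ev_ext i i'); auto. intros; apply H; lia. Qed.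


(** * Least elements and strictly increasing lists *)

Lemma lt_least (P : T -> Prop) : (exists x, P x) -> exists x, P x /\ forall y, P y -> ~ lt y x.
Proof.
  intros [x Hx]. revert Hx. induction x as [x IH] using (well_founded_ind lt_wf). intros Hx.
  destruct (classic (exists y, P y /\ lt y x)) as [(y & Hy & Hl)|H]; [eauto|].
  exists x; split; eauto.
Qed.

Lemma sorted_app_lt p x q y : StronglySorted lt (p ++ x :: q) -> In y p -> lt y x.
Proof.
  induction p as [|a p IH]; simpl; [contradiction|]. intros H [->|Hy]; inversion H; subst; auto.
  rewrite Forall_forall in *. apply H3, in_or_app; simpl; auto.
Qed.

Lemma sorted_NoDup l : StronglySorted lt l -> NoDup l.
Proof.
  induction 1; constructor; auto. intros Hi. rewrite Forall_forall in *.
  apply (lt_irr a); auto.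
Qed.

Lemma sorted_app_l p q : StronglySorted lt (p ++ q) -> StronglySorted lt p.
Proof.
  induction p as [|a p IH]; simpl; intros H; constructor; inversion H; subst; auto.
  rewrite Forall_forall in *. intros; apply H3, in_or_app; auto.
Qed.

Lemma sorted_app_r p q : StronglySorted lt (p ++ q) -> StronglySorted lt q.
Proof. induction p as [|a p IH]; simpl; auto. intros H; inversion H; auto. Qed.

Lemma sorted_snoc s x : StronglySorted lt s -> (forall y, In y s -> lt y x) ->
  StronglySorted lt (s ++ [x]).
Proof.
  induction 1 as [|a s H IH Ha]; simpl; intros Hx.
  - repeat constructor.
  - constructor; auto. rewrite Forall_forall in *. intros y Hy. apply in_app_or in Hy.
    destruct Hy as [Hy|[<-|[]]]; auto.
Qed.

Lemma NoDup_split_eq (p p' q q' : list T) x : NoDup (p ++ x :: q) -> p ++ x :: q = p' ++ x :: q' ->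
  p = p' /\ q = q'.
Proof.
  revert p'. induction p as [|a p IH]; intros [|a' p'] H E; simpl in *; inversion E; subst; auto.
  - inversion H; subst. destruct H2. apply in_or_app; simpl; auto.
  - inversion H; subst. destruct H2. apply in_or_app; simpl; auto.
  - inversion H; subst. destruct (IH p'); auto. subst; auto.
Qed.

(** * The recursion *)

(** For the sequence of x this is Xi_x(k+1), except that it is 0 when x lies in the root. *)
Definition ix (e : nat -> list T) k := idx k (length (e (S k))).

Definition succ y x := lt y x /\ forall z, ~ (lt y z /\ lt z x).

Definition limit x := (exists y, lt y x) /\ forall y, lt y x -> exists z, lt y z /\ lt z x.

(** Arbitrary throughout the construction; only capturing asks that every set of approximations be
    some [A t], and that is where CH enters. *)
Context (A : T -> nat -> list nat -> Prop).

(* [e] is the sequence k |-> (x)_k.  Only values of [f] below [x] matter, which is what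
   makes the recursion [good_exists] possible. *)
Record good (f : T -> nat -> list T) (x : T) (e : nat -> list T) : Prop := {
  g_len : forall k, length (e k) <= m k;
  g_last : forall k, exists s, e k = s ++ [x];
  g_sort : forall k, StronglySorted lt (e k);
  g_pref : forall k y, In y (e k) -> lt y x -> exists tl, e k = f y k ++ tl;
  g_down : forall k, e k = down k (e (S k));
  g_cof : forall y, lt y x -> exists k, In y (e k);
  g_size : forall q N, exists k, N <= k /\ length (e k) + q = r (S k);
  g_root : forall y N, lt y x ->
    exists k, N <= k /\ length (f y k) = r (S k) /\ ix e k = 0;
  g_succ : forall y k, succ y x -> length (f y k) < m k -> e k = f y k ++ [x];
  g_ride : limit x -> exists k0, forall t c l p, lt t x -> lt c x -> k0 <= l ->
    stay (A t) (ix e) l p ->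
    exists j b, lt b x /\ ~ lt b c /\ e (l + j) = f b (l + j) ++ [x] /\
      stay (A t) (ix (f b)) (l + j) (ev (ix e) l p j);
  g_free : limit x -> exists k0, forall t l p N, lt t x -> k0 <= l ->
    stay (A t) (ix e) l p ->
    exists j b, N <= l + j /\ lt b x /\ e (l + j) = f b (l + j) ++ [x] /\
      length (f b (l + j)) = r (S (l + j)) /\
      forall i, i < n (S (l + j)) -> A t (S (l + j)) (map (shift (l + j) i) (ev (ix e) l p j))
}.

Lemma good_local f g x e : (forall y, lt y x -> f y = g y) -> good f x e -> good g x e.
Proof.
  intros E G. split.
  - apply (g_len _ _ _ G).
  - apply (g_last _ _ _ G).
  - apply (g_sort _ _ _ G).
  - intros k y H1 H2. rewrite <- E by auto. apply (g_pref _ _ _ G); auto.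
  - apply (g_down _ _ _ G).
  - apply (g_cof _ _ _ G).
  - apply (g_size _ _ _ G).
  - intros y N H. rewrite <- E by auto. apply (g_root _ _ _ G); auto.
  - intros y k [H1 H2]. rewrite <- E by auto. apply (g_succ _ _ _ G). split; auto.
  - intros H. destruct (g_ride _ _ _ G H) as (k0 & H0). exists k0.
    intros t c l p H1 H2 H3 H4. destruct (H0 t c l p H1 H2 H3 H4) as (j & b & H5 & H6).
    exists j, b. rewrite <- E by auto. auto.
  - intros H. destruct (g_free _ _ _ G H) as (k0 & H0). exists k0.
    intros t l p N H1 H2 H3. destruct (H0 t l p N H1 H2 H3) as (j & b & H4 & H5 & H6).
    exists j, b. rewrite <- E by auto. auto.
Qed.

(** * Coherence of the sequences on an initial segment *)

Section Below.

Context (f : T -> nat -> list T) (D : T -> Prop).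
Hypothesis Ddown : forall x y, D x -> lt y x -> D y.
Hypothesis Hf : forall y, D y -> good f y (f y).

Lemma f_pos y k : D y -> 0 < length (f y k).
Proof.
  intros H. destruct (g_last _ _ _ (Hf y H) k) as [s ->]. rewrite length_app; simpl; lia.
Qed.

Lemma f_in_self y k : D y -> In y (f y k).
Proof.
  intros H. destruct (g_last _ _ _ (Hf y H) k) as [s ->]. apply in_or_app; simpl; auto.
Qed.

Lemma f_mono y k k' : D y -> k <= k' -> incl (f y k) (f y k').
Proof.
  intros H. induction 1; [apply incl_refl|].
  eapply incl_tran; [eauto|]. rewrite (g_down _ _ _ (Hf y H)). apply down_incl.
Qed.

Lemma f_in y z k : D y -> In z (f y k) -> z = y \/ lt z y.
Proof.
  intros H Hz. pose proof (g_sort _ _ _ (Hf y H) k) as Hs.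
  destruct (g_last _ _ _ (Hf y H) k) as [s E]. rewrite E in Hz, Hs.
  apply in_app_or in Hz. destruct Hz as [Hz|[->|[]]]; auto.
  right. eapply sorted_app_lt; eauto.
Qed.

Lemma f_inD y z k : D y -> In z (f y k) -> D z.
Proof. intros H Hz. destruct (f_in y z k H Hz) as [->|]; eauto. Qed.

Lemma f_pref y z k : D y -> In z (f y k) -> exists tl, f y k = f z k ++ tl.
Proof.
  intros H Hz. destruct (f_in y z k H Hz) as [->|Hl].
  - exists []; rewrite app_nil_r; auto.
  - apply (g_pref _ _ _ (Hf y H)); auto.
Qed.

(** (z)_k is an initial segment of (y)_k ending with z, and z occurs only once in (y)_k. *)
Lemma f_at y p z q k : D y -> f y k = p ++ z :: q -> f z k = p ++ [z].
Proof.
  intros H E. assert (Hz : In z (f y k)) by (rewrite E; apply in_or_app; simpl; auto).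
  destruct (f_pref y z k H Hz) as [tl E2].
  pose proof (f_inD y z k H Hz) as Dz.
  destruct (g_last _ _ _ (Hf z Dz) k) as [s Es].
  pose proof (sorted_NoDup _ (g_sort _ _ _ (Hf y H) k)) as Hn.
  rewrite E2, Es, <- app_assoc in E. simpl in E.
  rewrite E2, Es, <- app_assoc in Hn. simpl in Hn.
  destruct (NoDup_split_eq _ _ _ _ _ Hn E) as [-> _]. auto.
Qed.

(** Cutting (y)_k at a prescribed length gives some (z)_k; jump targets and the blocks of the scheme
    are found this way. *)
Lemma f_nth y k a : D y -> a < length (f y k) ->
  exists z, D z /\ In z (f y k) /\ f z k = firstn (S a) (f y k).
Proof.
  intros H Ha.
  destruct (nth_error (f y k) a) as [z|] eqn:E; [|apply nth_error_None in E; lia].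
  destruct (nth_error_split _ _ E) as (p & q & E1 & E2).
  assert (Hz : In z (f y k)) by (rewrite E1; apply in_or_app; simpl; auto).
  exists z. split; [eapply f_inD; eauto|]. split; auto.
  rewrite (f_at y p z q k H E1), E1, firstn_app, firstn_all2 by lia.
  rewrite E2. replace (S a - a) with 1 by lia. auto.
Qed.

Lemma f_lt_len y k z z' : D y -> In z (f y k) -> In z' (f y k) -> lt z z' ->
  length (f z k) < length (f z' k).
Proof.
  intros H Hz Hz' Hl. pose proof (f_inD _ _ _ H Hz') as Dz'.
  destruct (in_split _ _ Hz) as (p & q & E).
  rewrite (f_at y p z q k H E).
  destruct (in_split _ _ Hz') as (p' & q' & E').
  rewrite (f_at y p' z' q' k H E').
  rewrite !length_app; simpl.
  pose proof (g_sort _ _ _ (Hf y H) k) as Hs.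
  assert (length p <> length p' /\ ~ length p' < length p); [|lia].
  split; intros Hpp.
  - assert (nth_error (f y k) (length p) = nth_error (f y k) (length p')) as En by (rewrite Hpp; auto).
    rewrite E in En at 1. rewrite E' in En at 1.
    rewrite !nth_error_app2, !Nat.sub_diag in En by lia. simpl in En. inversion En; subst.
    apply (lt_irr z'); auto.
  - assert (In z' p).
    { apply nth_error_In with (n := length p').
      rewrite <- (nth_error_app1 p (z :: q)) by auto. rewrite <- E, E'.
      rewrite nth_error_app2, Nat.sub_diag by lia. auto. }
    rewrite E in Hs. pose proof (sorted_app_lt _ _ _ _ Hs H0).
    apply (lt_irr z); eauto.
Qed.

Lemma f_stable y k : D y -> length (f y k) <= r (S k) -> f y (S k) = f y k.
Proof.
  intros H Hl. rewrite (g_down _ _ _ (Hf y H) k) in Hl |- *. symmetry. apply down_root; auto.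
Qed.

Lemma f_stable_ix y k : D y -> length (f y k) <= r (S k) -> ix (f y) k = 0.
Proof. intros H Hl. unfold ix. rewrite f_stable by auto. apply idx_small; lia. Qed.

(** Since z survives in (y)_k, [down_app] puts it in the root or in the block of y at level k+1, so
    the index of y also moves z. *)
Lemma f_shift y k z : D y -> In z (f y k) ->
  length (f z (S k)) - 1 = shift k (ix (f y) k) (length (f z k) - 1).
Proof.
  intros H Hz. pose proof (f_inD _ _ _ H Hz) as Dz.
  assert (HzS : In z (f y (S k))) by (apply (f_mono y k); auto).
  rewrite (length_down_shift k (f z (S k))) by (apply f_pos; auto).
  rewrite <- (g_down _ _ _ (Hf z Dz)).
  destruct (f_pref y z (S k) H HzS) as [tl E].
  assert (Hc : length (f z (S k)) <= r (S k) \/ idx k (length (f z (S k))) = ix (f y) k).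
  { unfold ix. rewrite E. apply down_app.
    - exists z. split; [apply f_in_self; auto|]. split.
      + pose proof (sorted_NoDup _ (g_sort _ _ _ (Hf z Dz) (S k))) as Hn.
        destruct (g_last _ _ _ (Hf z Dz) (S k)) as [s Es]. rewrite Es in *.
        rewrite removelast_last. apply NoDup_remove_2 in Hn. rewrite app_nil_r in Hn. auto.
      + rewrite <- E, <- (g_down _ _ _ (Hf y H)). auto.
    - rewrite <- E. apply sorted_NoDup, (g_sort _ _ _ (Hf y H)). }
  destruct Hc as [Hc|Hc]; [|rewrite Hc; auto].
  assert (length (f z k) <= r (S k)).
  { rewrite (g_down _ _ _ (Hf z Dz)), down_small; lia. }
  pose proof (f_pos z k Dz).
  unfold shift. destruct (Nat.ltb_spec (length (f z k) - 1) (r (S k))); [auto|lia].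
Qed.

Lemma succ_exists y z : lt y z -> exists x, succ y x /\ (x = z \/ lt x z).
Proof.
  intros H. destruct (lt_least (lt y)) as (x & H1 & H2); [eauto|].
  exists x. split.
  - split; auto. intros u [Hu1 Hu2]. eapply H2; eauto.
  - destruct (lt_total x z) as [|[|Hzx]]; auto. destruct (H2 z H Hzx).
Qed.

Hypothesis Dsucc : forall y, D y -> exists z, D z /\ lt y z.

(** As long as there is room, the successor of the last element rides on it and adds one more;
    induction on the number of missing elements. *)
Lemma f_full y k : D y -> exists z tl, D z /\ f z k = f y k ++ tl /\ length (f z k) = m k.
Proof.
  remember (m k - length (f y k)) as d eqn:Ed. revert y Ed.
  induction d as [|d IH]; intros y Ed H; pose proof (g_len _ _ _ (Hf y H) k).
  - exists y, []. rewrite app_nil_r. repeat split; auto; lia.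
  - destruct (Dsucc y H) as (u & Du & Hu).
    destruct (succ_exists y u Hu) as (x & Hx & Hxu).
    assert (Dx : D x) by (destruct Hxu as [->|]; eauto).
    assert (E : f x k = f y k ++ [x]) by (apply (g_succ _ _ _ (Hf x Dx)); auto; lia).
    destruct (IH x) as (z & tl & Dz & E1 & E2); auto.
    { rewrite E, length_app; simpl; lia. }
    exists z, ([x] ++ tl). rewrite E1, E, <- app_assoc. repeat split; auto.
    rewrite <- E2, E1, E, <- app_assoc. auto.
Qed.

End Below.

(** * Sequences prescribed from some level on *)

Lemma extend_down k0 (g : nat -> list T) : (forall k, k0 <= k -> g k = down k (g (S k))) ->
  exists e, (forall k, k0 <= k -> e k = g k) /\ forall k, e k = down k (e (S k)).
Proof.
  revert g. induction k0 as [|k0 IH]; intros g Hg.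
  - exists g; split; auto. intros; apply Hg; lia.
  - destruct (IH (fun k => if k =? k0 then down k0 (g (S k0)) else g k)) as (e & H1 & H2).
    + intros k Hk. destruct (Nat.eqb_spec (S k) k0); [lia|].
      destruct (Nat.eqb_spec k k0) as [->|]; auto. apply Hg; lia.
    + exists e; split; auto. intros k Hk. rewrite H1 by lia.
      destruct (Nat.eqb_spec k k0); [lia|auto].
Qed.

Lemma down_ind k0 (P : nat -> Prop) : (forall k, k0 <= k -> P k) -> (forall k, P (S k) -> P k) ->
  forall k, P k.
Proof.
  intros H1 H2. induction k0 as [|k0 IH]; [intros; apply H1; lia|].
  apply IH. intros k Hk. destruct (Nat.eq_dec k k0) as [->|]; [apply H2, H1|apply H1]; lia.
Qed.

(** From [k0] on, order and coherence are inherited from the (b)_k to which x is appended. The lower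
    levels are forced by iterating [down], and [down_ind] carries each property to them. *)
Lemma build f x k0 (g : nat -> list T) :
  (forall y, lt y x -> good f y (f y)) ->
  (forall k, k0 <= k -> g k = down k (g (S k))) ->
  (forall k, k0 <= k -> length (g k) <= m k) ->
  (forall k, k0 <= k -> exists b, lt b x /\ g k = f b k ++ [x]) ->
  exists e, (forall k, k0 <= k -> e k = g k) /\
  (forall k, e k = down k (e (S k))) /\
  (forall k, length (e k) <= m k) /\
  (forall k, exists s, e k = s ++ [x]) /\
  (forall k, StronglySorted lt (e k)) /\
  (forall k y, In y (e k) -> lt y x -> exists tl, e k = f y k ++ tl).
Proof.
  intros Hf Hd Hl Hb.
  set (D := fun y => lt y x).
  assert (Dd : forall u v, D u -> lt v u -> D v) by (unfold D; eauto).
  destruct (extend_down k0 g Hd) as (e & He & Hed).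
  exists e. split; auto. split; auto.
  split.
  { apply (down_ind k0); [intros; rewrite He; auto|].
    intros k _. rewrite Hed. apply length_down_le. }
  split.
  { apply (down_ind k0).
    - intros k Hk. rewrite He by auto. destruct (Hb k Hk) as (b & _ & ->). eauto.
    - intros k [s Hs]. rewrite Hed, Hs. apply down_last. }
  assert (Hs : forall k, StronglySorted lt (e k)).
  { apply (down_ind k0).
    - intros k Hk. rewrite He by auto. destruct (Hb k Hk) as (b & Db & ->).
      apply sorted_snoc; [apply (g_sort _ _ _ (Hf b Db))|].
      intros y Hy. destruct (f_in f D Hf b y k Db Hy) as [->|]; eauto.
    - intros k Hk. rewrite Hed. apply down_sorted; auto. }
  split; auto.
  apply (down_ind k0 (fun k => forall y, In y (e k) -> lt y x -> exists tl, e k = f y k ++ tl)).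
  - intros k Hk y Hy Hyx. rewrite He in * by auto. destruct (Hb k Hk) as (b & Db & E). rewrite E in *.
    apply in_app_or in Hy. destruct Hy as [Hy|[->|[]]]; [|exfalso; eapply lt_irr; eauto].
    destruct (f_pref f D Hf b y k Db Hy) as [tl ->].
    rewrite <- app_assoc; eauto.
  - intros k IH y Hy Hyx.
    assert (HyS : In y (e (S k))) by (rewrite Hed in Hy; apply down_incl in Hy; auto).
    destruct (IH y HyS Hyx) as [tl E].
    destruct (down_app k (f y (S k)) tl) as [[tl' E'] _].
    + exists y. split; [apply (f_in_self f D Hf); auto|]. split.
      * pose proof (sorted_NoDup _ (g_sort _ _ _ (Hf y Hyx) (S k))) as Hn.
        destruct (g_last _ _ _ (Hf y Hyx) (S k)) as [s Es]. rewrite Es in *.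
        rewrite removelast_last. apply NoDup_remove_2 in Hn. rewrite app_nil_r in Hn. auto.
      * rewrite <- E, <- Hed. auto.
    + rewrite <- E. apply sorted_NoDup; auto.
    + exists tl'. rewrite Hed, E, E', <- (g_down _ _ _ (Hf y Hyx)). auto.
Qed.

(** * Recursion step: zero and successors *)

Lemma nat_least (P : nat -> Prop) : (exists k, P k) -> exists k, P k /\ forall j, P j -> k <= j.
Proof.
  intros [k Hk]. revert Hk. induction k as [k IH] using (well_founded_ind Nat.lt_wf_0). intros Hk.
  destruct (classic (exists j, P j /\ j < k)) as [(j & Hj & Hl)|H]; [eauto|].
  exists k; split; auto. intros j Hj. destruct (le_lt_dec k j); auto. destruct H; eauto.
Qed.

Lemma zero_step f x : (forall y, ~ lt y x) -> exists e, good f x e.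
Proof.
  intros Hx. exists (fun _ => [x]). split.
  - intros [|k]; simpl; [rewrite m_0; auto|]. pose proof (m_ltS k); lia.
  - intros; exists []; auto.
  - intros; repeat constructor.
  - intros k y _ H; destruct (Hx _ H).
  - intros k. symmetry. apply down_small. simpl; lia.
  - intros y H; destruct (Hx _ H).
  - intros q N. destruct (r_inf (S q) N) as (k & ? & ?). exists k; split; auto.
  - intros y N H; destruct (Hx _ H).
  - intros y k [H _]; destruct (Hx _ H).
  - intros [[y H] _]; destruct (Hx _ H).
  - intros [[y H] _]; destruct (Hx _ H).
Qed.

Section Step.

Context (f : T -> nat -> list T) (x : T).
Hypothesis Hf : forall y, lt y x -> good f y (f y).

Let D := fun y => lt y x.
Let Dd : forall u v, D u -> lt v u -> D v.
Proof. unfold D; eauto. Qed.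

Lemma ride_step b k : lt b x -> length (f b k) < m k ->
  down k (f b (S k) ++ [x]) = f b k ++ [x] /\
  idx k (S (length (f b (S k)))) = ix (f b) k /\ length (f b (S k)) < m (S k).
Proof.
  intros Hb Hl. pose proof (Hf b Hb) as G.
  rewrite (g_down _ _ _ G k) in Hl |- *. unfold ix.
  destruct (down_ride k (f b (S k)) x) as (H1 & H2 & H3); auto.
  - pose proof (f_pos f D Hf b (S k) Hb). intros E. rewrite E in *. simpl in *; lia.
  - apply (g_len _ _ _ G).
Qed.

Lemma below_max b k k' : lt b x -> length (f b k) < m k -> k <= k' -> length (f b k') < m k'.
Proof. intros Hb Hl. induction 1; auto. apply ride_step; auto. Qed.

Lemma below_max_ex b N : lt b x -> exists k, N <= k /\ length (f b k) < m k.
Proof.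
  intros Hb. destruct (g_size _ _ _ (Hf b Hb) 0 N) as (k & H1 & H2).
  exists k; split; auto. pose proof (r_lt k). lia.
Qed.

Lemma succ_step y : succ y x -> exists e, good f x e.
Proof.
  intros [Hyx Hno].
  (* The least level is taken because [g_succ] prescribes riding at every level with room; once
     there is room, there is room at all later levels. *)
  destruct (nat_least (fun k => length (f y k) < m k)) as (k0 & Hk0 & Hmin).
  { destruct (below_max_ex y 0 Hyx) as (k & _ & H); eauto. }
  assert (Hk : forall k, k0 <= k -> length (f y k) < m k).
  { intros k. apply below_max; auto. }
  assert (Hz : forall z, lt z x -> z = y \/ lt z y).
  { intros z Hzx. destruct (lt_total z y) as [|[|H]]; auto. destruct (Hno z); auto. }
  destruct (build f x k0 (fun k => f y k ++ [x]) Hf) as (e & He & H1 & H2 & H3 & H4 & H5).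
  - intros k H. symmetry. apply ride_step; auto.
  - intros k H. rewrite length_app; simpl. specialize (Hk k H). lia.
  - eauto.
  - assert (Hix : forall k, k0 <= k -> ix e k = ix (f y) k).
    { intros k H. unfold ix at 1. rewrite He by lia. rewrite length_app, Nat.add_comm. simpl.
      apply ride_step; auto. }
    pose proof (Hf y Hyx) as G.
    exists e. split; auto.
    + intros z Hzx.
      assert (exists k, In z (f y k)) as [k Hin].
      { destruct (Hz z Hzx) as [->|Hl]; [exists 0; apply (f_in_self f D Hf); auto|].
        apply (g_cof _ _ _ G); auto. }
      exists (k0 + k). rewrite He by lia. apply in_or_app; left.
      apply (f_mono f D Hf y k); auto. lia.
    (* One more than q is requested from y, because x adds an element. *)
    + intros q N. destruct (g_size _ _ _ G (S q) (k0 + N)) as (k & Hk1 & Hk2).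
      exists k; split; [lia|]. rewrite He by lia. rewrite length_app; simpl; lia.
    + intros z N Hzx. destruct (Hz z Hzx) as [->|Hl].
      * destruct (g_size _ _ _ G 0 (k0 + N)) as (k & Hk1 & Hk2).
        exists k. split; [lia|]. split; [lia|]. rewrite Hix by lia.
        apply (f_stable_ix f D Hf); auto. lia.
      * destruct (g_root _ _ _ G z (k0 + N) Hl) as (k & Hk1 & Hk2 & Hk3).
        exists k. rewrite Hix by lia. repeat split; auto; lia.
    + intros z k [Hzx Hzno] Hl. destruct (Hz z Hzx) as [->|Hzy]; [|destruct (Hzno y); auto].
      apply He, Hmin, Hl.
    + intros [_ Hl]. destruct (Hl y Hyx) as (z & ?). destruct (Hno z); auto.
    + intros [_ Hl]. destruct (Hl y Hyx) as (z & ?). destruct (Hno z); auto.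
Qed.

(** * Recursion step at limits: finite and infinite paths *)

Section Path.

Context (k0 : nat).
Hypothesis Hlim : limit x.

Definition st k b := lt b x /\ length (f b k) < m k.

(* [(b)_k ++ [x]] is the k-th segment of x when [(z)_{k+1} ++ [x]] is the next one. *)
Definition step k b z := down k (f z (S k) ++ [x]) = f b k ++ [x].

(** A finite path from level [k0] to level k, encoded as a total function; its values at other
    levels are arbitrary. *)
Definition valid k (B : nat -> T) := k0 <= k /\ (forall j, k0 <= j <= k -> st j (B j)) /\
  forall j, k0 <= j < k -> step j (B j) (B (S j)).

Definition path (B : nat -> T) := forall j, k0 <= j -> st j (B j) /\ step j (B j) (B (S j)).

Definition agree k (B B' : nat -> T) := forall j, j <= k -> B' j = B j.

(** Density in the sense of forcing: some finite extension must guarantee P for every infinite path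
    through it. *)
Definition dense (P : (nat -> T) -> Prop) := forall k B, valid k B ->
  exists k' B', k <= k' /\ valid k' B' /\ agree k B B' /\
    forall B'', path B'' -> agree k' B' B'' -> P B''.

(* The block index [ix e j] of the sequence [e k = f (B k) k ++ [x]]. *)
Definition ixB (B : nat -> T) j := idx j (S (length (f (B (S j)) (S j)))).

Lemma agree_trans k k' B B' B'' : k <= k' -> agree k B B' -> agree k' B' B'' -> agree k B B''.
Proof. intros H H1 H2 j Hj. rewrite H2, H1; auto; lia. Qed.

Lemma ixB_ride B j : st j (B j) -> B (S j) = B j -> ixB B j = ix (f (B j)) j.
Proof. intros [H1 H2] E. unfold ixB. rewrite E. apply ride_step; auto. Qed.

Lemma append_state k B z : valid k B -> st (S k) z -> step k (B k) z ->
  exists B', valid (S k) B' /\ agree k B B' /\ B' (S k) = z.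
Proof.
  intros (H1 & H2 & H3) Hst Hstep.
  exists (fun j => if j <=? k then B j else z). split; [|split].
  - split; [lia|]. split.
    + intros j Hj. destruct (Nat.leb_spec j k); [apply H2; lia|].
      replace j with (S k) by lia. auto.
    + intros j Hj. destruct (Nat.leb_spec j k); [|lia].
      destruct (Nat.leb_spec (S j) k); [apply H3; lia|]. replace j with k by lia. auto.
  - intros j Hj. destruct (Nat.leb_spec j k); [auto|lia].
  - destruct (Nat.leb_spec (S k) k); [lia|auto].
Qed.

Lemma ride k B k' : valid k B -> k <= k' ->
  exists B', valid k' B' /\ agree k B B' /\ forall j, k <= j <= k' -> B' j = B k.
Proof.
  intros Hv. induction 1 as [|k' Hk IH].
  - exists B. split; auto. split; [intros ? ?; auto|]. intros j Hj. replace j with k by lia; auto.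
  - destruct IH as (B' & V & Ag & E).
    assert (Hst : st k' (B' k')) by (apply V; destruct V; lia).
    destruct (append_state k' B' (B' k')) as (B'' & V'' & Ag'' & E''); auto.
    + split; [apply Hst|]. apply ride_step; apply Hst.
    + apply ride_step; apply Hst.
    + exists B''. split; auto. split; [eapply agree_trans; eauto|].
      intros j Hj. destruct (Nat.eq_dec j (S k')) as [->|]; [rewrite E''|rewrite Ag'' by lia];
        apply E; lia.
Qed.

Lemma jump k B z i : valid k B -> lt z x -> 1 <= i < n (S k) ->
  length (f z (S k)) = r (S k) + i * width k -> firstn (r (S k)) (f z (S k)) = f (B k) k ->
  exists B', valid (S k) B' /\ agree k B B' /\ B' (S k) = z.
Proof.
  intros Hv Hz Hi Hl E. apply append_state; auto.
  - split; auto. rewrite Hl, m_S. pose proof (width_pos k). nia.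
  - unfold step. rewrite <- E. apply down_jump with (i := i); auto.
Qed.

Lemma below_full y k : lt y x ->
  exists z tl, lt z x /\ f z k = f y k ++ tl /\ length (f z k) = m k.
Proof.
  intros Hy. apply (f_full f D Dd Hf); auto.
  intros u Hu. destruct Hlim as [_ H]. destruct (H u Hu) as (z & ? & ?). eauto.
Qed.

(** Complete (y)_{k+1} to a set of F_{k+1} and cut it just before block i. Its root is (b)_k, which
    already has r_{k+1} elements and therefore does not change at level k+1. *)
Lemma jump_target b k i : lt b x -> length (f b k) = r (S k) -> 1 <= i < n (S k) ->
  forall y, lt y x -> In b (f y (S k)) ->
  exists z, lt z x /\ length (f z (S k)) = r (S k) + i * width k /\
    firstn (r (S k)) (f z (S k)) = f b k /\
    (length (f y (S k)) <= r (S k) + i * width k -> In y (f z (S k))).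
Proof.
  intros Hb Hl Hi y Hy Hin.
  destruct (below_full y (S k) Hy) as (u & tl & Du & Eu & Lu).
  pose proof (width_pos k). pose proof (m_S k).
  destruct (f_nth f D Dd Hf u (S k) (r (S k) + i * width k - 1) Du) as (z & Dz & Hz & Ez); [nia|].
  replace (S (r (S k) + i * width k - 1)) with (r (S k) + i * width k) in Ez by nia.
  exists z. split; auto. rewrite Ez, length_firstn. split; [nia|]. split.
  - rewrite firstn_firstn, Nat.min_l by nia. rewrite Eu.
    destruct (f_pref f D Hf y b (S k) Hy Hin) as [tl' ->].
    rewrite (f_stable f D Hf b k) by (auto; lia).
    rewrite <- app_assoc, firstn_app, <- Hl, Nat.sub_diag, firstn_all. simpl.
    apply app_nil_r.
  - intros Hlen. rewrite Eu, firstn_app, firstn_all2 by auto.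
    apply in_or_app; left. apply (f_in_self f D Hf); auto.
Qed.

(* For u > b: ride on b to a level k where (b)_k is the root of a set of F_{k+1} having u
   in its first block, then jump over that block. *)
Lemma reach k B u N : valid k B -> lt u x ->
  exists k' B', k <= k' /\ N <= k' /\ valid k' B' /\ agree k B B' /\ In u (f (B' k') k').
Proof.
  intros Hv Hu.
  assert (exists k' B', k <= k' /\ valid k' B' /\ agree k B B' /\ In u (f (B' k') k'))
    as (k1 & B1 & Hk1 & V1 & Ag1 & In1).
  { assert (Hst : st k (B k)) by (apply Hv; destruct Hv; lia).
    destruct Hst as [Hb Hm]. set (b := B k) in *.
    destruct (lt_total u b) as [Hub|[->|Hbu]].
    - destruct (g_cof _ _ _ (Hf b Hb) u Hub) as [k1 Hin].
      destruct (ride k B (k + k1) Hv) as (B' & V & Ag & E); [lia|].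
      exists (k + k1), B'. split; [lia|]. split; auto. split; auto.
      rewrite E by lia. apply (f_mono f D Hf b k1); auto; lia.
    - exists k, B. split; [lia|]. split; auto. split; [intros ? ?; auto|].
      apply (f_in_self f D Hf); auto.
    - destruct (g_cof _ _ _ (Hf u Hu) b Hbu) as [k1 Hin].
      destruct (g_root _ _ _ (Hf u Hu) b (k + k1) Hbu) as (k2 & Hk2 & Hr & Hix).
      destruct (ride k B k2 Hv) as (B' & V & Ag & E); [lia|].
      assert (Hbk : B' k2 = b) by (apply E; lia).
      pose proof (n_ge2 k2).
      destruct (jump_target b k2 1 Hb Hr) with (y := u) as (z & Hz & Lz & Fz & Iz); auto.
      { apply (f_mono f D Hf u k1); auto; lia. }
      destruct (jump k2 B' z 1) as (B2 & V2 & Ag2 & E2); auto.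
      { rewrite Fz, Hbk; auto. }
      exists (S k2), B2. split; [lia|]. split; auto.
      split; [apply (agree_trans k k2 B B' B2); auto; lia|].
      rewrite E2. apply Iz.
      (* Index 0 means that (u)_{k2+1} equals (u)_{k2}, which has at most m_{k2} elements, so u lies
         before the cut. *)
      rewrite <- (down_idx0 k2 (f u (S k2))) by auto.
      pose proof (length_down_le k2 (f u (S k2))). pose proof (m_width k2). lia. }
  destruct (ride k1 B1 (k1 + N) V1) as (B2 & V2 & Ag2 & E2); [lia|].
  exists (k1 + N), B2. split; [lia|]. split; [lia|]. split; auto.
  split; [eapply agree_trans; eauto|].
  rewrite E2 by lia. apply (f_mono f D Hf (B1 k1) k1); auto; [|lia].
  apply V1; destruct V1; lia.
Qed.

(** * The requirements on a generic path and their density *)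

Lemma dense_true : dense (fun _ => True).
Proof. intros k B V. exists k, B. split; auto. split; auto. split; auto. intros ? ?; auto. Qed.

Lemma dense_and P Q : dense P -> dense Q -> dense (fun B => P B /\ Q B).
Proof.
  intros HP HQ k B V. destruct (HP k B V) as (k1 & B1 & H1 & V1 & A1 & F1).
  destruct (HQ k1 B1 V1) as (k2 & B2 & H2 & V2 & A2 & F2).
  exists k2, B2. split; [lia|]. split; auto. split; [eapply agree_trans; eauto|].
  intros B3 P3 A3. split; [apply F1|apply F2]; auto. eapply agree_trans; eauto.
Qed.

(** For q = 0, (x)_k is exactly as large as a root, so that a jump is possible; larger q leave room
    for the successors of x to reach the same size. *)
Definition size_req q N (B : nat -> T) :=
  exists k, N <= k /\ k0 <= k /\ S (length (f (B k) k)) + q = r (S k).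

(** At such levels (y)_k can serve as a root while x has index 0; [reach] needs this at later limits
    to climb from y past x. *)
Definition root_req y N (B : nat -> T) :=
  exists k, N <= k /\ k0 <= k /\ length (f y k) = r (S k) /\ ixB B k = 0.

Definition cof_req u (B : nat -> T) := exists k, k0 <= k /\ In u (f (B k) k).

(** Designed for the descent: a position staying in A_t along x is handed over to an ordinal below x
    that is still not below c. *)
Definition ride_req t c l p (B : nat -> T) := k0 <= l -> stay (A t) (ixB B) l p ->
  exists j, ~ lt (B (l + j)) c /\
    stay (A t) (ix (f (B (l + j)))) (l + j) (ev (ixB B) l p j).

(** Designed for capturing: at some level where x may be put in any block, no block leads out of
    A_t. *)
Definition free_req t l p N (B : nat -> T) := k0 <= l -> stay (A t) (ixB B) l p ->
  exists j, N <= l + j /\ length (f (B (l + j)) (l + j)) = r (S (l + j)) /\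
    forall i, i < n (S (l + j)) -> A t (S (l + j)) (map (shift (l + j) i) (ev (ixB B) l p j)).

Lemma valid_st k B : valid k B -> st k (B k).
Proof. intros V. apply V. destruct V; lia. Qed.

Lemma valid_k0 k B : valid k B -> k0 <= k.
Proof. intros V. apply V. Qed.

Lemma size_dense q N : dense (size_req q N).
Proof.
  intros k B V. destruct (valid_st k B V) as [Hb Hm].
  destruct (g_size _ _ _ (Hf _ Hb) (S q) (k + N)) as (k1 & H1 & H2).
  destruct (ride k B k1 V) as (B1 & V1 & A1 & E1); [lia|].
  exists k1, B1. split; [lia|]. split; auto. split; auto.
  intros B2 P2 A2. exists k1. split; [lia|]. split; [apply (valid_k0 _ _ V1)|].
  rewrite A2, E1 by lia. lia.
Qed.

Lemma cof_dense u : lt u x -> dense (cof_req u).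
Proof.
  intros Hu k B V. destruct (reach k B u 0 V Hu) as (k1 & B1 & H1 & _ & V1 & A1 & I1).
  exists k1, B1. split; [lia|]. split; auto. split; auto.
  intros B2 P2 A2. exists k1. split; [apply (valid_k0 _ _ V1)|]. rewrite A2; auto.
Qed.

(** While x rides on b its indices are those of b, so an index 0 of b at level [k1] is passed on to
    x. *)
Lemma ride_zero_dense (P : (nat -> T) -> Prop) k B k1 : valid k B -> k <= k1 ->
  ix (f (B k)) k1 = 0 ->
  (forall B'', path B'' -> agree k B B'' -> (forall j, k <= j <= S k1 -> B'' j = B k) ->
     (forall j, k <= j <= k1 -> ixB B'' j = ix (f (B k)) j) -> P B'') ->
  exists k' B', k <= k' /\ valid k' B' /\ agree k B B' /\
    forall B'', path B'' -> agree k' B' B'' -> P B''.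
Proof.
  intros V Hk Hi HP. destruct (ride k B (S k1) V) as (B1 & V1 & A1 & E1); [lia|].
  exists (S k1), B1. split; [lia|]. split; auto. split; auto.
  intros B2 P2 A2.
  assert (Hj : forall j, k <= j <= S k1 -> B2 j = B k).
  { intros j Hj. rewrite A2, E1 by lia; auto. }
  apply HP; auto.
  - apply (agree_trans k (S k1) B B1 B2); auto; lia.
  - intros j Hj'. rewrite ixB_ride; [rewrite Hj by lia; auto| |rewrite !Hj by lia; auto].
    apply P2. pose proof (valid_k0 _ _ V). lia.
Qed.

(** Once [reach] has put y into (b)_k, either y = b, and (b)_k has the size of a root at arbitrarily
    high levels, or [g_root] for b applies to y; riding passes this on to x. *)
Lemma root_dense y N : lt y x -> dense (root_req y N).
Proof.
  intros Hy k B V. destruct (reach k B y 0 V Hy) as (k1 & B1 & H1 & _ & V1 & A1 & I1).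
  destruct (valid_st k1 B1 V1) as [Hb Hm].
  assert (exists k2, k1 + N <= k2 /\ length (f y k2) = r (S k2) /\ ix (f (B1 k1)) k2 = 0)
    as (k2 & H2 & H3 & H4).
  { destruct (f_in f D Hf (B1 k1) y k1 Hb I1) as [->|Hl].
    - destruct (g_size _ _ _ (Hf _ Hb) 0 (k1 + N)) as (k2 & H2 & H3).
      exists k2. split; auto. split; [lia|]. apply (f_stable_ix f D Hf); auto; lia.
    - apply (g_root _ _ _ (Hf _ Hb)); auto. }
  destruct (ride_zero_dense (root_req y N) k1 B1 k2 V1) as (k' & B' & H5 & H6 & H7 & H8); auto; [lia| |].
  - intros B2 P2 A2 E2 I2. exists k2. pose proof (valid_k0 _ _ V1).
    split; [lia|]. split; [lia|]. split; auto. rewrite I2 by lia. auto.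
  - exists k', B'. split; [lia|]. split; auto. split; [eapply agree_trans; eauto|auto].
Qed.

Lemma ev_agree k B B' l p j : l + j <= k -> agree k B B' -> ev (ixB B) l p j = ev (ixB B') l p j.
Proof.
  intros H Ag. apply ev_ext. intros i Hi. unfold ixB. rewrite Ag by lia. auto.
Qed.

(** After c is reached, either riding forever on the current b stays in A_t, which meets the
    requirement, or it leaves A_t at some level; riding that far then falsifies the hypothesis of
    the requirement. *)
Lemma ride_dense t c l p : lt c x -> dense (ride_req t c l p).
Proof.
  intros Hc k B V. destruct (reach k B c l V Hc) as (k1 & B1 & H1 & Hl & V1 & A1 & I1).
  destruct (valid_st k1 B1 V1) as [Hb Hm]. set (b := B1 k1) in *.
  assert (Hbc : ~ lt b c).
  { intros H. destruct (f_in f D Hf b c k1 Hb I1) as [->|Hcb]; [apply (lt_irr b); auto|].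
    apply (lt_irr b); eauto. }
  destruct (classic (stay (A t) (ix (f b)) k1 (ev (ixB B1) l p (k1 - l)))) as [Hs|Hs].
  - exists k1, B1. split; auto. split; auto. split; auto.
    intros B2 P2 A2 Hkl _. exists (k1 - l). replace (l + (k1 - l)) with k1 by lia.
    rewrite A2 by lia. fold b. split; auto.
    rewrite <- (ev_agree k1 B1) by (auto; lia). auto.
  - apply not_all_ex_not in Hs. destruct Hs as [j Hj].
    destruct (ride k1 B1 (k1 + j) V1) as (B2 & V2 & A2 & E2); [lia|].
    exists (k1 + j), B2. split; [lia|]. split; auto. split; [eapply agree_trans; eauto|].
    intros B3 P3 A3 Hkl Hst. exfalso. apply Hj.
    specialize (Hst (k1 - l + j)). rewrite ev_add in Hst.
    replace (l + (k1 - l + j)) with (k1 + j) in Hst by lia.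
    replace (l + (k1 - l)) with k1 in Hst by lia.
    rewrite (ev_agree k1 B1 B3); [|lia|apply (agree_trans k1 (k1 + j) B1 B2 B3); auto; lia].
    rewrite <- (ev_ext (ixB B3)); auto.
    intros i Hi. rewrite ixB_ride; [rewrite A3, E2 by lia; auto| |rewrite !A3, !E2 by lia; auto].
    apply P3. pose proof (valid_k0 _ _ V1). lia.
Qed.

Lemma free_dense t l p N : dense (free_req t l p N).
Proof.
  intros k B V. destruct (valid_st k B V) as [Hb Hm]. set (b := B k) in *.
  destruct (g_size _ _ _ (Hf _ Hb) 0 (k + N + l)) as (k1 & H1 & H2).
  destruct (ride k B k1 V) as (B1 & V1 & A1 & E1); [lia|].
  assert (Eb : B1 k1 = b) by (apply E1; lia).
  destruct (classic (forall i, i < n (S k1) ->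
    A t (S k1) (map (shift k1 i) (ev (ixB B1) l p (k1 - l))))) as [Hs|Hs].
  - exists k1, B1. split; [lia|]. split; auto. split; auto.
    intros B2 P2 A2 Hkl _. exists (k1 - l). replace (l + (k1 - l)) with k1 by lia.
    split; [lia|]. rewrite <- (ev_agree k1 B1) by (auto; lia). split; auto.
    rewrite A2, Eb by lia. lia.
  - apply not_all_ex_not in Hs. destruct Hs as [i Hi]. apply imply_to_and in Hi.
    destruct Hi as [Hi Hni].
    (* Index i at level [k1] takes the positions out of A_t, so the requirement holds vacuously. *)
    assert (Hkill : forall B3, path B3 -> agree k1 B1 B3 -> ixB B3 k1 = i -> free_req t l p N B3).
    { intros B3 P3 A3 E3 Hkl Hst. exfalso. apply Hni.
      specialize (Hst (S (k1 - l))). simpl in Hst.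
      replace (l + S (k1 - l)) with (S k1) in Hst by lia.
      replace (l + (k1 - l)) with k1 in Hst by lia.
      rewrite E3 in Hst. rewrite (ev_agree k1 B1 B3); auto; lia. }
    (* Block 0 is entered by riding, a later block by a jump. *)
    destruct i as [|i].
    + destruct (ride_zero_dense (free_req t l p N) k1 B1 k1 V1) as (k' & B' & H5 & H6 & H7 & H8); auto.
      * rewrite Eb. apply (f_stable_ix f D Hf); auto; lia.
      * intros B3 P3 A3 E3 I3. apply Hkill; auto. rewrite I3 by lia. rewrite Eb.
        apply (f_stable_ix f D Hf); auto; lia.
      * exists k', B'. split; [lia|]. split; auto.
        split; [apply (agree_trans k k1 B B1 B'); auto; lia|auto].
    + destruct (jump_target b k1 (S i) Hb) with (y := b) as (z & Hz & Lz & Fz & Iz); auto; try lia.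
      { apply (f_in_self f D Hf); auto. }
      destruct (jump k1 B1 z (S i)) as (B2 & V2 & A2 & E2); auto; [lia|rewrite Fz, Eb; auto|].
      exists (S k1), B2. split; [lia|]. split; auto.
      split; [apply (agree_trans k k1 B B1 B2); auto; lia|].
      intros B3 P3 A3. apply Hkill; auto.
      * apply (agree_trans k1 (S k1) B1 B2 B3); auto; lia.
      * unfold ixB. rewrite A3, E2 by lia. apply (down_jump k1 (f z (S k1)) x (S i)); auto.
Qed.

(* Rasiowa-Sikorski for countably many dense sets of finite paths. *)
Lemma generic (P : nat -> (nat -> T) -> Prop) (B0 : nat -> T) :
  valid k0 B0 -> (forall i, dense (P i)) -> exists B, path B /\ forall i, P i B.
Proof.
  intros V0 HP.
  assert (Hn : forall ic : nat * (nat * (nat -> T)), exists c' : nat * (nat -> T),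
    let i := fst ic in let c := snd ic in
    valid (fst c) (snd c) -> fst c < fst c' /\ valid (fst c') (snd c') /\
      agree (fst c) (snd c) (snd c') /\
      forall B, path B -> agree (fst c') (snd c') B -> P i B).
  { intros [i [k B]]. simpl. destruct (classic (valid k B)) as [V|V]; [|exists (k, B); tauto].
    destruct (HP i k B V) as (k1 & B1 & H1 & V1 & A1 & F1).
    (* Riding one more level makes the finite paths strictly longer, so their union is an infinite
       path. *)
    destruct (ride k1 B1 (S k1) V1) as (B2 & V2 & A2 & E2); [lia|].
    exists (S k1, B2). simpl. intros _. split; [lia|]. split; auto.
    split; [eapply agree_trans; eauto|]. intros B3 P3 A3. apply F1; auto.
    apply (agree_trans k1 (S k1) B1 B2 B3); auto; lia. }
  apply choice in Hn. destruct Hn as [nxt Hn].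
  set (s := fix s i := match i with 0 => (k0, B0) | S i => nxt (i, s i) end).
  assert (Hs : forall i, valid (fst (s i)) (snd (s i)) /\ i <= fst (s i)).
  { induction i as [|i [IH1 IH2]]; [split; [auto|simpl; lia]|].
    destruct (Hn (i, s i) IH1) as (H1 & H2 & _). simpl in H1. split; [exact H2|].
    change (S i <= fst (nxt (i, s i))). lia. }
  assert (Ha : forall i j, i <= j -> agree (fst (s i)) (snd (s i)) (snd (s j)) /\ fst (s i) <= fst (s j)).
  { intros i j. induction 1 as [|j Hj [IH1 IH2]]; [split; [intros ? ?; auto|auto]|].
    destruct (Hn (j, s j) (proj1 (Hs j))) as (H1 & _ & H3 & _). simpl in H1, H3.
    change (s (S j)) with (nxt (j, s j)). split; [|lia]. eapply agree_trans; eauto. }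
  set (B := fun j => snd (s j) j).
  assert (HB : forall i, agree (fst (s i)) (snd (s i)) B).
  { intros i j Hj. unfold B. destruct (le_lt_dec i j) as [H|H].
    - apply Ha; auto.
    - symmetry. apply Ha; [lia|]. apply Hs. }
  assert (PB : path B).
  { intros j Hj. destruct (Hs (S j)) as [V Hl].
    rewrite !(HB (S j)) by lia. destruct V as (_ & V1 & V2). split; [apply V1|apply V2]; lia. }
  exists B. split; auto. intros i.
  destruct (Hn (i, s i) (proj1 (Hs i))) as (_ & _ & _ & F). apply F; auto. apply (HB (S i)).
Qed.


Lemma path_good B : path B -> (forall q N, size_req q N B) ->
  (forall y N, lt y x -> root_req y N B) ->
  (forall u, lt u x -> cof_req u B) ->
  (forall t c l p, lt t x -> lt c x -> ride_req t c l p B) ->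
  (forall t l p N, lt t x -> free_req t l p N B) ->
  exists e, good f x e.
Proof.
  intros PB H1 H2 H3 H4 H5.
  assert (Hb : forall k, k0 <= k -> lt (B k) x) by (intros k Hk; apply (PB k Hk)).
  destruct (build f x k0 (fun k => f (B k) k ++ [x]) Hf) as (e & He & E1 & E2 & E3 & E4 & E5).
  - intros k Hk. symmetry. apply (PB k Hk).
  - intros k Hk. rewrite length_app; simpl. destruct (PB k Hk) as [[_ ?] _]. lia.
  - intros k Hk. eauto.
  - assert (Hix : forall k, k0 <= k -> ixB B k = ix e k).
    { intros k Hk. unfold ix, ixB. rewrite He, length_app by lia. simpl. f_equal. lia. }
    exists e. split; auto.
    + intros y Hy. destruct (H3 y Hy) as (k & Hk & Hin). exists k. rewrite He by auto.
      apply in_or_app; auto.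
    + intros q N. destruct (H1 q N) as (k & Hk1 & Hk2 & Hk3). exists k. split; auto.
      rewrite He, length_app by auto; simpl. lia.
    + intros y N Hy. destruct (H2 y N Hy) as (k & Hk1 & Hk2 & Hk3 & Hk4).
      exists k. rewrite <- Hix by auto. auto.
    + intros y k [Hy Hno]. destruct Hlim as [_ Hl]. destruct (Hl y Hy) as (z & ?). destruct (Hno z); auto.
    + intros _. exists k0. intros t c l p Ht Hc Hl Hst.
      destruct (H4 t c l p Ht Hc Hl) as (j & Hj1 & Hj2).
      { eapply stay_ext; [|eauto]. intros; symmetry; apply Hix; lia. }
      exists j, (B (l + j)). rewrite He by lia. split; [apply Hb; lia|]. split; auto. split; auto.
      rewrite (ev_ext (ix e) (ixB B)); auto. intros; symmetry; apply Hix; lia.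
    + intros _. exists k0. intros t l p N Ht Hl Hst.
      destruct (H5 t l p N Ht Hl) as (j & Hj1 & Hj2 & Hj3).
      { eapply stay_ext; [|eauto]. intros; symmetry; apply Hix; lia. }
      exists j, (B (l + j)). rewrite He by lia. split; auto. split; [apply Hb; lia|]. split; auto.
      split; auto.
      rewrite (ev_ext (ix e) (ixB B)); auto. intros; symmetry; apply Hix; lia.
Qed.

End Path.

Lemma enum_below : (exists y, lt y x) ->
  exists g : nat -> T, (forall i, lt (g i) x) /\ forall y, lt y x -> exists i, g i = y.
Proof.
  intros [y0 Hy0]. destruct (proj2 (proj2 (proj2 (proj2 (proj2 Homega1)))) x) as [h Hh].
  assert (H : forall i, exists y, lt y x /\ forall z, lt z x -> h z = i -> z = y).
  { intros i. destruct (classic (exists z, lt z x /\ h z = i)) as [(z & H1 & Hi)|H].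
    - exists z. split; auto. intros z' H2 H3. apply Hh; auto; congruence.
    - exists y0; split; auto. intros z H1 H2. destruct H; eauto. }
  apply choice in H. destruct H as [g Hg]. exists g. split; [apply Hg|].
  intros y Hy. exists (h y). symmetry. apply Hg; auto.
Qed.

Lemma limit_step : limit x -> exists e, good f x e.
Proof.
  intros Hlim. destruct (enum_below (proj1 Hlim)) as (g & Hg & Hgs).
  destruct (proj1 Hlim) as [b Hb].
  destruct (below_max_ex b 0 Hb) as (k0 & _ & Hk0).
  destruct code_dec as [dec Hdec].
  (* One code carries the parameters of all five requirements: [a] names the ordinal t, y or u, [c]
     the ordinal c, and [l] serves both as q and as a level. *)
  set (P := fun i B => match dec i with
    | a :: c :: l :: N :: p =>
        (((size_req k0 l N B /\ root_req k0 (g a) N B) /\ cof_req k0 (g a) B) /\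
         ride_req k0 (g a) (g c) l p B) /\ free_req k0 (g a) l p N B
    | _ => True end).
  destruct (generic k0 P (fun _ => b)) as (B & PB & HB).
  - split; [lia|]. split; [|lia]. intros j Hj. replace j with k0 by lia. split; auto.
  - intros i. unfold P. destruct (dec i) as [|a [|c [|l [|N p]]]];
      [apply dense_true .. |].
    apply dense_and; [apply dense_and; [apply dense_and; [apply dense_and|]|]|].
    + apply size_dense.
    + apply root_dense; auto.
    + apply cof_dense; auto.
    + apply ride_dense; auto.
    + apply free_dense; auto.
  - assert (HP : forall a c l N p, (((size_req k0 l N B /\ root_req k0 (g a) N B) /\
         cof_req k0 (g a) B) /\ ride_req k0 (g a) (g c) l p B) /\ free_req k0 (g a) l p N B).
    { intros a c l N p. specialize (HB (code (a :: c :: l :: N :: p))). unfold P in HB.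
      rewrite Hdec in HB. auto. }
    apply (path_good k0 Hlim B); auto.
    + intros q N. apply (HP 0 0 q N []).
    + intros y N Hy. destruct (Hgs y Hy) as [a <-]. apply (HP a 0 0 N []).
    + intros y Hy. destruct (Hgs y Hy) as [a <-]. apply (HP a 0 0 0 []).
    + intros t c l p Ht Hc. destruct (Hgs t Ht) as [a <-]. destruct (Hgs c Hc) as [c' <-].
      apply (HP a c' l 0 p).
    + intros t l p N Ht. destruct (Hgs t Ht) as [a <-]. apply (HP a 0 l N p).
Qed.

Lemma good_step : exists e, good f x e.
Proof.
  destruct (classic (exists y, lt y x)) as [H|H].
  - destruct (classic (exists y, succ y x)) as [[y Hy]|Hs]; [apply (succ_step y Hy)|].
    apply limit_step. split; auto. intros y Hy. apply NNPP. intros Hn. apply Hs.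
    exists y. split; auto. intros z Hz. apply Hn. eauto.
  - apply zero_step. eauto.
Qed.

End Step.

Lemma good_exists : exists f, forall x, good f x (f x).
Proof.
  apply (wf_choice lt (fun _ => [])); auto.
  - intros f g x e E G. eapply good_local; eauto.
  - intros f x Hf. apply good_step; auto.
Qed.

(** * Entries of sorted lists and bounds in omega_1 *)

Lemma in_slice a b (l : list T) x :
  In x (firstn b (skipn a l)) <-> exists j, a <= j < a + b /\ nth_error l j = Some x.
Proof.
  split.
  - intros H. apply In_nth_error in H. destruct H as [j H].
    assert (Hj : j < b).
    { destruct (le_lt_dec b j) as [Hj|]; auto.
      rewrite (proj2 (nth_error_None _ _)) in H; [discriminate|].
      rewrite length_firstn. lia. }
    rewrite nth_error_firstn in H. destruct (Nat.ltb_spec j b); [|lia].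
    rewrite nth_error_skipn in H. exists (a + j). split; auto. lia.
  - intros (j & Hj & H). apply nth_error_In with (n := j - a).
    rewrite nth_error_firstn. destruct (Nat.ltb_spec (j - a) b); [|lia].
    rewrite nth_error_skipn. replace (a + (j - a)) with j by lia. auto.
Qed.

Lemma in_firstn b (l : list T) x :
  In x (firstn b l) <-> exists j, j < b /\ nth_error l j = Some x.
Proof.
  change l with (skipn 0 l) at 1. rewrite in_slice.
  split; intros (j & H1 & H2); exists j; split; auto; lia.
Qed.

Lemma sorted_nth l i j x y : StronglySorted lt l -> nth_error l i = Some x ->
  nth_error l j = Some y -> i < j -> lt x y.
Proof.
  intros H. revert i j. induction H as [|a l H IH Ha]; intros i j Hx Hy Hij.
  - destruct i; discriminate.
  - destruct j as [|j]; [lia|]. destruct i as [|i]; simpl in *.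
    + inversion Hx; subst. rewrite Forall_forall in Ha. apply Ha. eapply nth_error_In; eauto.
    + eapply IH; eauto. lia.
Qed.

Lemma sorted_firstn a l : StronglySorted lt l -> StronglySorted lt (firstn a l).
Proof. intros H. rewrite <- (firstn_skipn a l) in H. eapply sorted_app_l; eauto. Qed.

Lemma sorted_nth_inj l i j x : StronglySorted lt l -> nth_error l i = Some x ->
  nth_error l j = Some x -> i = j.
Proof.
  intros H Hi Hj. destruct (Nat.lt_trichotomy i j) as [Hij|[|Hij]]; auto; destruct (lt_irr x).
  - exact (sorted_nth l i j x x H Hi Hj Hij).
  - exact (sorted_nth l j i x x H Hj Hi Hij).
Qed.

(** Otherwise every ordinal is at most some s_i, and omega_1 is a countable union of countable
    sets. *)
Lemma omega1_bounded (s : nat -> T) : exists z, forall i, lt (s i) z.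
Proof.
  apply NNPP. intros Hn.
  apply (proj1 (proj2 (proj2 (proj2 (proj2 Homega1))))).
  apply (countable_sub _ (fun x => exists i, True /\ (lt x (s i) \/ x = s i))).
  - intros x _. apply NNPP. intros Hx. apply Hn. exists x. intros i.
    destruct (lt_total (s i) x) as [|[<-|H]]; auto; destruct Hx; exists i; auto.
  - apply countable_union; [exists (fun i => i); auto|]. intros i _.
    apply countable_or; [apply Homega1|apply countable_single].
Qed.

Lemma omega1_inhabited : inhabited T.
Proof.
  apply NNPP. intros H. apply (proj1 (proj2 (proj2 (proj2 (proj2 Homega1))))).
  exists (fun _ => 0). intros x. destruct H. constructor; auto.
Qed.

Lemma omega1_unbounded x : exists z, lt x z.
Proof. destruct (omega1_bounded (fun _ => x)) as [z Hz]. exists z; apply (Hz 0). Qed.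

(** * The scheme *)

Section Family.

Context (f : T -> nat -> list T).
Hypothesis Hf : forall x, good f x (f x).

Let D := fun _ : T => True.
Let Dd : forall x y, D x -> lt y x -> D y.
Proof. unfold D; auto. Qed.
Let Df : forall y, D y -> good f y (f y).
Proof. auto. Qed.
Let Du : forall y, D y -> exists z, D z /\ lt y z.
Proof. intros y _. destruct (omega1_unbounded y) as [z Hz]. exists z; split; auto. exact I. Qed.

(* A member of F_k is (x)_k for its last element x. *)
Definition family (E : list T) := exists x k, E = f x k /\ length E = m k.

Lemma full_above x k : exists z tl, f z k = f x k ++ tl /\ length (f z k) = m k.
Proof. destruct (f_full f D Dd Df Du x k I) as (z & tl & _ & H). eauto. Qed.

Lemma sort_f x k : StronglySorted lt (f x k).
Proof. apply (g_sort _ _ _ (Hf x)). Qed.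

(** (z')_k is an initial segment of (y)_k, and what follows it lies above z'. *)
Lemma f_lt_in y k z z' : In z (f y k) -> In z' (f y k) -> lt z z' -> In z (f z' k).
Proof.
  intros Hz Hz' Hl. destruct (f_pref f D Df y z' k I Hz') as [tl E].
  rewrite E in Hz. apply in_app_or in Hz. destruct Hz as [|Hz]; auto. exfalso.
  apply in_split in Hz. destruct Hz as (p & q & ->). pose proof (sort_f y k) as Hs.
  rewrite E, app_assoc in Hs. apply (lt_irr z). apply (lt_trans z z' z); auto.
  apply (sorted_app_lt _ _ _ z' Hs). apply in_or_app; left. apply (f_in_self f D Df); exact I.
Qed.

Definition block k i (E : list T) :=
  firstn (r (S k)) E ++ firstn (width k) (skipn (r (S k) + i * width k) E).

Lemma in_block k i E x : In x (block k i E) <-> exists j, nth_error E j = Some x /\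
  (j < r (S k) \/ r (S k) + i * width k <= j < r (S k) + S i * width k).
Proof.
  unfold block. rewrite in_app_iff, in_firstn, in_slice. split.
  - intros [(j & H1 & H2)|(j & H1 & H2)]; exists j; split; auto. right; lia.
  - intros (j & H1 & [H2|H2]); [left|right]; exists j; split; auto; lia.
Qed.

(** The cut list ends in block i, so [down] keeps the root and this block. Through [f_nth] the block
    is then recognised as a member of F_k. *)
Lemma block_down k i E : i < n (S k) -> length E = m (S k) ->
  block k i E = down k (firstn (r (S k) + S i * width k) E).
Proof.
  intros Hi HE. pose proof (m_S k). pose proof (width_pos k).
  assert (Hl : length (firstn (r (S k) + S i * width k) E) = r (S k) + S i * width k).
  { rewrite length_firstn. nia. }
  unfold down, block. rewrite Hl.
  rewrite (idx_eq k _ i (width k - 1)) by lia.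
  rewrite firstn_firstn, Nat.min_l by lia. f_equal.
  rewrite skipn_firstn_comm. f_equal. lia.
Qed.

Lemma block_family y k i : i < n (S k) -> length (f y (S k)) = m (S k) ->
  family (block k i (f y (S k))) /\ length (block k i (f y (S k))) = m k /\
  StronglySorted lt (block k i (f y (S k))).
Proof.
  intros Hi HE. pose proof (m_S k). pose proof (width_pos k). pose proof (m_width k).
  assert (Hl : length (block k i (f y (S k))) = m k).
  { unfold block. rewrite length_app, !length_firstn, length_skipn. nia. }
  destruct (f_nth f D Dd Df y (S k) (r (S k) + i * width k + (width k - 1)) I) as (z & _ & Hz & Ez);
    [nia|].
  replace (S (r (S k) + i * width k + (width k - 1))) with (r (S k) + S i * width k) in Ez by lia.
  assert (E : block k i (f y (S k)) = f z k).
  { rewrite block_down, <- Ez by auto. symmetry. apply (g_down _ _ _ (Hf z)). }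
  split; [|split; auto].
  - exists z, k. auto.
  - rewrite E. apply sort_f.
Qed.

Lemma family_decomp y k : length (f y (S k)) = m (S k) ->
  decomp lt m n r family (f y (S k)) (S k) (fun i => block k i (f y (S k)))
    (firstn (r (S k)) (f y (S k))).
Proof.
  intros HE. pose proof (m_S k). pose proof (width_pos k). pose proof (n_ge2 k).
  set (E := f y (S k)) in *. pose proof (sort_f y (S k)) as Hs. fold E in Hs.
  assert (Htail : forall i x, In x (block k i E) /\ ~ In x (firstn (r (S k)) E) ->
    exists j, nth_error E j = Some x /\ r (S k) + i * width k <= j < r (S k) + S i * width k).
  { intros i x [Hx Hnx]. apply in_block in Hx. destruct Hx as (j & Hj & [Hl|Hl]); [|eauto].
    destruct Hnx. apply in_firstn. eauto. }
  split; [|split; [|split]].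
  - intros i Hi. simpl. rewrite Nat.sub_0_r.
    destruct (block_family y k i Hi HE) as (H2 & H3 & _). auto.
  - split; auto. split; [|split; [|split; [|split; [|split]]]].
    + intros i Hi. apply StronglySorted_Sorted, block_family; auto.
    + apply StronglySorted_Sorted, sorted_firstn; auto.
    + intros i Hi. transitivity (m k); [|symmetry]; apply block_family; auto; lia.
    + intros i j Hij x. rewrite !in_block, in_firstn. split.
      * intros [(a & Ha & Ca) (b & Hb & Cb)].
        assert (a = b) by (eapply sorted_nth_inj; eauto). subst b.
        exists a. split; auto. nia.
      * intros (a & Ha & Hx). split; exists a; auto.
    + intros i Hi u v Hu Hv. apply in_firstn in Hu. destruct Hu as (a & Ha & Hu).
      destruct (Htail _ _ Hv) as (b & Hv' & Hb). eapply sorted_nth; eauto. lia.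
    + intros i j Hij u v Hu Hv.
      destruct (Htail _ _ Hu) as (a & Hu' & Ha). destruct (Htail _ _ Hv) as (b & Hv' & Hb).
      eapply sorted_nth; eauto. nia.
  - rewrite length_firstn. lia.
  - intros x. split.
    + intros Hx. apply In_nth_error in Hx. destruct Hx as [j Hj].
      assert (j < length E) by (apply nth_error_Some; congruence).
      (* [idx] takes a length, hence S j for position j; elements of the root get block 0. *)
      exists (idx k (S j)). split; [apply idx_lt; lia|].
      apply in_block. exists j. split; auto.
      destruct (idx_cases k (S j)) as [Hc|(b & Hb & Ec)]; lia.
    + intros (i & Hi & Hx). apply in_block in Hx. destruct Hx as (j & Hj & _).
      eapply nth_error_In; eauto.
Qed.

Lemma family_scheme : is_scheme lt m n r family.
Proof.
  split; [|split; [|split]].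
  - intros E (x & k & -> & Hl). split; [|split].
    + intros E. pose proof (f_in_self f D Df x k I) as H. rewrite E in H. destruct H.
    + apply StronglySorted_Sorted, sort_f.
    + eauto.
  - intros L.
    (* The largest ordinal met so far is kept as x, and the level is raised until (x)_k contains the
       others. *)
    assert (exists x k, forall a, In a L -> In a (f x k)) as (x & k & H).
    { induction L as [|a L (x & k & IH)].
      - destruct omega1_inhabited as [x]. exists x, 0. intros ? [].
      - destruct (lt_total a x) as [H|[<-|H]].
        + destruct (g_cof _ _ _ (Hf x) a H) as [k1 H1]. exists x, (k + k1).
          intros b [<-|Hb]; [apply (f_mono f D Df x k1)|apply (f_mono f D Df x k)];
            auto; try exact I; lia.
        + exists a, k. intros b [<-|Hb]; auto. apply (f_in_self f D Df); exact I.
        + destruct (g_cof _ _ _ (Hf a) x H) as [k1 H1]. exists a, (k + k1).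
          intros b [<-|Hb]; [apply (f_in_self f D Df); exact I|].
          assert (Hx : In x (f a (k + k1))).
          { apply (f_mono f D Df a k1); auto; try exact I; lia. }
          destruct (f_pref f D Df a x (k + k1) I Hx) as [tl ->].
          apply in_or_app; left. apply (f_mono f D Df x k); auto; try exact I; lia. }
    destruct (full_above x k) as (z & tl & E & Hl).
    exists (f z k). split; [exists z, k; auto|].
    intros a Ha. rewrite E. apply in_or_app; auto.
  - intros k E F (x0 & k1 & -> & H1) (x1 & k2 & -> & H2) H3 H4 x y Hx Hx' Hy Hl.
    rewrite H3 in H1. rewrite H4 in H2. apply m_inj in H1, H2. subst k1 k2.
    assert (In y (f x k)) by (eapply f_lt_in; eauto).
    destruct (f_pref f D Df x1 x k I Hx') as [tl ->]. apply in_or_app; auto.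
  - intros k E (x & k1 & -> & H1) H2. rewrite H2 in H1. apply m_inj in H1. subst k1.
    do 2 eexists. apply family_decomp; auto.
Qed.

(** * The functions rho, Delta and Xi of the scheme *)

Lemma rho_le_iff x y k : lt y x -> (rho_le m family y x k <-> In y (f x k)).
Proof.
  intros Hl. split.
  - intros (k' & Hk & E & (z & k1 & -> & H1) & H2 & Hy & Hx).
    rewrite H2 in H1. apply m_inj in H1. subst k1.
    apply (f_mono f D Df x k'); auto; try exact I. eapply f_lt_in; eauto.
  - intros Hy. destruct (full_above x k) as (z & tl & E & Hm).
    exists k. split; auto. exists (f z k). split; [exists z, k; auto|]. split; auto.
    rewrite E. split; apply in_or_app; left; auto. apply (f_in_self f D Df); exact I.
Qed.

(** By [rho_le_iff] the list [f x k] is (x)_k; removing its last entry x leaves the set counted by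
    the norm. *)
Lemma below_card x k : card_is (below lt m family x k) (length (f x k) - 1).
Proof.
  destruct (g_last _ _ _ (Hf x) k) as [s E]. pose proof (sort_f x k) as Hs.
  exists s. rewrite E in Hs. split; [|split].
  - apply sorted_NoDup. eapply sorted_app_l; eauto.
  - intros y. unfold below. split.
    + intros Hy. assert (lt y x) by (eapply sorted_app_lt; eauto). split; auto.
      apply rho_le_iff; auto. rewrite E. apply in_or_app; auto.
    + intros [Hl Hr]. apply rho_le_iff in Hr; auto. rewrite E in Hr.
      apply in_app_or in Hr. destruct Hr as [|[->|[]]]; auto. destruct (lt_irr y); auto.
  - rewrite E, length_app. simpl. lia.
Qed.

Lemma len_pos x k : 0 < length (f x k).
Proof. apply (f_pos f D Df); exact I. Qed.

Lemma length_f_down x y k j : j <= k -> length (f x k) = length (f y k) ->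
  length (f x j) = length (f y j).
Proof.
  induction 1; auto. intros E. apply IHle.
  rewrite (g_down _ _ _ (Hf x)), (g_down _ _ _ (Hf y)), !length_down, E. auto.
Qed.

(** The length of (x)_j depends only on that of (x)_{j+1}, so agreement at level k propagates to all
    lower levels. *)
Lemma Delta_intro x y k : length (f x k) = length (f y k) ->
  length (f x (S k)) <> length (f y (S k)) -> Delta_eq lt m family x y (S k).
Proof.
  intros E1 E2. split.
  - intros j Hj. exists (length (f x j) - 1). split; [apply below_card|].
    rewrite (length_f_down x y k j) by (auto; lia). apply below_card.
  - exists (length (f x (S k)) - 1), (length (f y (S k)) - 1).
    split; [|split; apply below_card].
    pose proof (len_pos x (S k)). pose proof (len_pos y (S k)). lia.
Qed.

Lemma f_nth_last x k : nth_error (f x k) (length (f x k) - 1) = Some x.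
Proof.
  destruct (g_last _ _ _ (Hf x) k) as [s ->]. rewrite length_app. simpl.
  rewrite nth_error_app2 by lia. replace (length s + 1 - 1 - length s) with 0 by lia. auto.
Qed.

Lemma Xi_intro x k : Xi_eq lt m n r family x (S k)
  (if length (f x (S k)) - 1 <? r (S k) then (-1)%Z else Z.of_nat (ix (f x) k)).
Proof.
  destruct (full_above x (S k)) as (z & tl & E & Hm).
  pose proof (len_pos x (S k)) as Hp.
  pose proof (f_nth_last x (S k)) as Hn.
  assert (Hnz : nth_error (f z (S k)) (length (f x (S k)) - 1) = Some x).
  { rewrite E, nth_error_app1 by lia. auto. }
  do 3 eexists. split; [exists z, (S k); auto|]. split; auto.
  split; [eapply nth_error_In; eauto|]. split; [apply family_decomp; auto|].
  destruct (Nat.ltb_spec (length (f x (S k)) - 1) (r (S k))) as [H|H].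
  - left. split; auto. apply in_firstn. eauto.
  - right. exists (ix (f x) k). split; auto.
    split; [apply idx_lt, (g_len _ _ _ (Hf x))|]. split.
    + apply in_block. eexists. split; [eauto|]. right. unfold ix.
      destruct (idx_cases k (length (f x (S k))) Hp) as [Hc|(b & Hb & Ec)]; lia.
    + intros Hx. apply in_firstn in Hx. destruct Hx as (j & Hj & Hx).
      assert (j = length (f x (S k)) - 1) by (eapply sorted_nth_inj; [apply sort_f|eauto..]). lia.
Qed.

(** z is the supremum of a strictly increasing sequence starting above all s_i. *)
Lemma limit_above (s : nat -> T) : exists z, limit z /\ forall i, lt (s i) z.
Proof.
  destruct (omega1_bounded s) as [z0 Hz0].
  destruct (choice _ omega1_unbounded) as [up Hup].
  set (s2 := fix s2 i := match i with 0 => z0 | S i => up (s2 i) end).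
  destruct (lt_least (fun z => forall i, lt (s2 i) z) (omega1_bounded s2)) as (z & Hz & Hmin).
  exists z. split; [|intros i; apply (lt_trans _ z0); [auto|apply (Hz 0)]].
  split; [exists z0; apply (Hz 0)|]. intros y Hy.
  assert (exists i, ~ lt (s2 i) y) as [i Hi].
  { apply NNPP. intros Hn. apply (Hmin y); auto. intros i. apply NNPP. eauto. }
  exists (s2 (S i)). split; [|apply Hz].
  pose proof (Hup (s2 i) : lt (s2 i) (s2 (S i))) as H.
  destruct (lt_total (s2 i) y) as [|[<-|]]; eauto. contradiction.
Qed.

(** * Capturing *)

Section Capture.

Context (F : list T -> Prop).
Hypothesis Fsorted : forall E, F E -> E <> [] /\ StronglySorted lt E.

(** With such an R, a root-tail-tail Δ-system can be picked one member at a time, each tail above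
    the previous ones. *)
Definition cofinal_tails R (P : list T -> Prop) := forall c, exists tl, tl <> [] /\ F (R ++ tl) /\
  (forall y, In y tl -> ~ lt y c) /\ P tl.

(** If R fails, the tails begin below a fixed c. As c has only countably many predecessors,
    uncountably many members share one first element z of the tail; append z to R and continue with
    shorter tails. *)
Lemma root_aux d R : ~ countable_pred (fun E => F E /\ exists tl, E = R ++ tl /\ length tl = d) ->
  exists R', cofinal_tails R' (fun _ => True).
Proof.
  revert R. induction d as [|d IH]; intros R Hu.
  - destruct Hu. apply (countable_sub _ (fun E => E = R)); [|apply countable_single].
    intros E (_ & tl & -> & Hl). destruct tl; [apply app_nil_r|discriminate].
  - destruct (classic (cofinal_tails R (fun _ => True))) as [|Hn]; [eauto|].
    apply not_all_ex_not in Hn. destruct Hn as [c Hn].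
    destruct (classic (exists z, ~ countable_pred (fun E => F E /\ exists tl,
      E = (R ++ [z]) ++ tl /\ length tl = d))) as [[z Hz]|Hall]; [exact (IH _ Hz)|].
    destruct Hu. apply (countable_sub _ (fun E => exists z, lt z c /\ (F E /\ exists tl,
      E = (R ++ [z]) ++ tl /\ length tl = d))).
    + intros E (HE & tl & -> & Hl). destruct tl as [|z tl]; [discriminate|].
      exists z. split; [|split; [auto|exists tl; rewrite <- app_assoc; auto]].
      apply NNPP. intros Hzc. apply Hn. exists (z :: tl). split; [discriminate|]. split; auto.
      split; auto. destruct (Fsorted _ HE) as [_ Hs]. apply sorted_app_r in Hs.
      inversion Hs as [|z' tl' Hs' Hz E1]; subst. rewrite Forall_forall in Hz.
      intros y [<-|Hy] Hyc; [auto|]. apply Hzc. exact (lt_trans z y c (Hz y Hy) Hyc).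
    + apply countable_union; [apply Homega1|]. intros z _. apply NNPP. intros Hz.
      apply Hall. exists z. exact Hz.
Qed.

Lemma root_exists : ~ countable_pred F -> exists R, cofinal_tails R (fun _ => True).
Proof.
  intros Hu. apply NNPP. intros Hn. apply Hu.
  apply (countable_sub _ (fun E => exists d, True /\ (F E /\ exists tl, E = [] ++ tl /\ length tl = d))).
  - intros E HE. exists (length E). split; auto. split; auto. exists E; auto.
  - apply countable_union; [exists (fun i => i); auto|]. intros d _. apply NNPP.
    intros Hd. apply Hn. eapply root_aux; eauto.
Qed.

Definition pos k y := length (f y k) - 1.

(** The ordinal a ensures that E lies in one member of F_k, in which [pos] gives the positions. *)
Definition snapshot k p (E : list T) :=
  (exists a, forall y, In y E -> In y (f a k)) /\ p = map (pos k) E.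

Context (R : list T).

Definition realised k p := cofinal_tails R (fun tl => snapshot k p (R ++ tl)).

Context (t0 c0 : T).
Hypothesis Ht0 : forall k p, A t0 k p <-> realised k p.
Hypothesis Hc0 : limit c0.
Hypothesis Htc : lt t0 c0.
Hypothesis HRc : forall y, In y R -> lt y c0.

(* In a set of F_l containing (a)_l, the positions [q] are those of elements above c0. *)
Definition tail_positions a l q := forall b z, In b q -> In z (f a l) -> lt z c0 -> pos l z < b.

(** The positions of R are actual ones, whereas those in q need not belong to elements of (a)_l;
    this allows a to drop to c0. *)
Definition candidate a l p := ~ lt a c0 /\ stay (A t0) (ix (f a)) l p /\
  (forall y, In y R -> In y (f a l)) /\
  exists q, p = map (pos l) R ++ q /\ tail_positions a l q.

Lemma shift_lt k i a b : a < b -> shift k i a < shift k i b.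
Proof.
  unfold shift. destruct (Nat.ltb_spec a (r (S k))), (Nat.ltb_spec b (r (S k))); lia.
Qed.

Lemma pos_nth a k b z : nth_error (f a k) b = Some z -> pos k z = b.
Proof.
  intros H. destruct (nth_error_split _ _ H) as (p & q & E & <-).
  unfold pos. rewrite (f_at f D Dd Df a p z q k I E), length_app. simpl. lia.
Qed.

Lemma nth_pos a k z : In z (f a k) -> nth_error (f a k) (pos k z) = Some z.
Proof.
  intros H. destruct (In_nth_error _ _ H) as [b Hb]. rewrite (pos_nth a k b z Hb). auto.
Qed.

Lemma pos_shift a k z : In z (f a k) -> pos (S k) z = shift k (ix (f a) k) (pos k z).
Proof. apply (f_shift f D Dd Df); exact I. Qed.

Lemma pos_self_shift k z : pos (S k) z = shift k (ix (f z) k) (pos k z).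
Proof. apply pos_shift, (f_in_self f D Df); exact I. Qed.

(** If z is already in (a)_l, monotonicity of [shift] suffices. A new z lies in a block before that
    of a, so it is enough that b is outside the root; otherwise the element at position b would be
    below z, hence below c0, against the assumption on q. *)
Lemma tail_positions_S a l q : ~ lt a c0 -> tail_positions a l q ->
  tail_positions a (S l) (map (shift l (ix (f a) l)) q).
Proof.
  intros Ha Hq b' z Hb' Hz Hzc. apply in_map_iff in Hb'. destruct Hb' as (b & <- & Hb).
  set (i := ix (f a) l).
  destruct (classic (In z (f a l))) as [Hin|Hin].
  - rewrite (pos_shift a) by auto. apply shift_lt. eauto.
  - assert (Hzp : r (S l) <= pos (S l) z < r (S l) + i * width l).
    { pose proof (nth_pos a (S l) z Hz) as Hn.
      rewrite (g_down _ _ _ (Hf a) l) in Hin. unfold down in Hin. rewrite in_app_iff in Hin.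
      fold (ix (f a) l) in Hin. fold i in Hin.
      split.
      - destruct (le_lt_dec (r (S l)) (pos (S l) z)); auto. destruct Hin. left.
        apply in_firstn. eauto.
      - destruct (le_lt_dec (r (S l) + i * width l) (pos (S l) z)); auto. destruct Hin. right.
        apply nth_error_In with (n := pos (S l) z - (r (S l) + i * width l)).
        rewrite nth_error_skipn. rewrite <- Hn. f_equal. lia. }
    unfold shift. destruct (Nat.ltb_spec b (r (S l))) as [Hbr|Hbr]; [|lia].
    exfalso.
    assert (Hlen : pos (S l) z < length (f a (S l))).
    { apply nth_error_Some. rewrite nth_pos; [discriminate|auto]. }
    destruct (nth_error (f a (S l)) b) as [u|] eqn:Eu.
    2: { apply nth_error_None in Eu. lia. }
    assert (Hu : In u (f a l)).
    { rewrite (g_down _ _ _ (Hf a) l). unfold down. apply in_or_app; left.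
      apply in_firstn. eauto. }
    assert (Hup : pos l u = b).
    { pose proof (pos_nth _ _ _ _ Eu) as E. rewrite (pos_shift a) in E by auto. unfold shift in E.
      destruct (Nat.ltb_spec (pos l u) (r (S l))); lia. }
    assert (Huz : lt u z).
    { eapply sorted_nth; [apply (sort_f a (S l))|exact Eu|apply nth_pos; auto|lia]. }
    specialize (Hq b u Hb Hu (lt_trans _ _ _ Huz Hzc)). lia.
Qed.

Lemma candidate_S a l p : candidate a l p -> candidate a (S l) (map (shift l (ix (f a) l)) p).
Proof.
  intros (H1 & H2 & H3 & q & -> & H4). split; auto. split; [|split].
  - pose proof (stay_shift _ _ _ _ 1 H2) as H. simpl in H.
    rewrite Nat.add_0_r, Nat.add_1_r in H. exact H.
  - intros y Hy. apply (f_mono f D Df a l); auto. exact I.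
  - exists (map (shift l (ix (f a) l)) q). split; [|apply tail_positions_S; auto].
    rewrite map_app, map_map. f_equal. apply map_ext_in. intros y Hy. symmetry. apply pos_shift; auto.
Qed.

Lemma candidate_ev a l p j : candidate a l p -> candidate a (l + j) (ev (ix (f a)) l p j).
Proof.
  intros H. induction j as [|j IH]; [rewrite Nat.add_0_r; auto|].
  rewrite Nat.add_succ_r. apply candidate_S; auto.
Qed.

(** The only element lost is a, which is not in R because it is not below c0. *)
Lemma candidate_pred a b l p : candidate a l p -> lt b a -> ~ lt b c0 -> f a l = f b l ++ [a] ->
  stay (A t0) (ix (f b)) l p -> candidate b l p.
Proof.
  intros (H1 & H2 & H3 & q & -> & H4) Hba Hb E Hs. split; auto. split; auto. split.
  - intros y Hy. specialize (H3 y Hy). rewrite E in H3. apply in_app_or in H3.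
    destruct H3 as [|[->|[]]]; auto. destruct H1; auto.
  - exists q. split; auto. intros u z Hu Hz. apply H4; auto. rewrite E. apply in_or_app; auto.
Qed.

(** Well-founded induction on a: a successor hands the positions to its predecessor, on which it
    rides from some level on; a limit hands them to the ordinal supplied by [g_ride]. *)
Lemma descend a l p : candidate a l p -> exists l' p', candidate c0 l' p'.
Proof.
  revert l p. induction a as [a IH] using (well_founded_ind lt_wf). intros l p Hc.
  destruct (lt_total a c0) as [H|[->|Hl]]; [destruct Hc as [Hc _]; contradiction|eauto|].
  assert (Hfa : forall y, lt y a -> good f y (f y)) by auto.
  destruct (classic (exists y, succ y a)) as [[y Hy]|Hs].
  - pose proof (proj1 Hy) as Hya.
    (* Otherwise c0 would lie strictly between y and its successor a. *)
    assert (Hyc : ~ lt y c0) by (intros H; destruct (proj2 Hy c0); auto).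
    destruct (below_max_ex f a Hfa y l Hya) as (k & Hk & Hm).
    assert (Hmk : forall k', k <= k' -> length (f y k') < m k')
      by (intros k'; apply (below_max f a Hfa); auto).
    assert (He : forall k', k <= k' -> f a k' = f y k' ++ [a])
      by (intros; apply (g_succ _ _ _ (Hf a)); auto).
    pose proof (candidate_ev a l p (k - l) Hc) as Hc'. replace (l + (k - l)) with k in Hc' by lia.
    apply (IH y Hya k (ev (ix (f a)) l p (k - l))). apply (candidate_pred a); auto.
    eapply stay_ext; [|apply Hc']. intros k' Hk'. unfold ix at 1.
    rewrite He, length_app, Nat.add_comm by lia. simpl. apply (ride_step f a Hfa); auto.
  - assert (Ha : limit a).
    { split; [eauto|]. intros y Hy. apply NNPP. intros Hn. apply Hs.
      exists y. split; auto. intros z Hz. apply Hn. eauto. }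
    destruct (g_ride _ _ _ (Hf a) Ha) as (k0 & Hr).
    pose proof (candidate_ev a l p k0 Hc) as Hc'.
    destruct (Hr t0 c0 (l + k0) (ev (ix (f a)) l p k0)) as (j & b & Hb & Hbc & E & Hst);
      [eauto|auto|lia|apply Hc'|].
    apply (IH b Hb _ _ (candidate_pred _ _ _ _ (candidate_ev _ _ _ j Hc') Hb Hbc E Hst)).
Qed.

Hypothesis Hbound : forall k p, ~ realised k p ->
  forall tl, tl <> [] -> F (R ++ tl) -> (forall y, In y tl -> ~ lt y c0) ->
  ~ snapshot k p (R ++ tl).

(** Take for a the last element of the member and l so large that (a)_l contains it. Its positions
    at all levels from l on are snapshots of this one member, so [Hbound] forces them to be
    realised. *)
Lemma candidate_exists : (exists tl, tl <> [] /\ F (R ++ tl) /\ forall y, In y tl -> ~ lt y c0) ->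
  exists a l p, candidate a l p.
Proof.
  intros (tl & Hne & HF & Htl).
  destruct (exists_last Hne) as (tl' & a & E).
  assert (Hs : StronglySorted lt ((R ++ tl') ++ [a])).
  { rewrite <- app_assoc, <- E. apply Fsorted; auto. }
  assert (Ha : ~ lt a c0) by (apply Htl; rewrite E; apply in_or_app; simpl; auto).
  assert (Hle : forall y, In y (R ++ tl) -> y = a \/ lt y a).
  { rewrite E, app_assoc. intros y Hy. apply in_app_or in Hy. destruct Hy as [Hy|[->|[]]]; auto.
    right. eapply sorted_app_lt; eauto. }
  assert (exists l, forall y, In y (R ++ tl) -> In y (f a l)) as [l Hl].
  { clear HF. induction (R ++ tl) as [|y L IH].
    - exists 0. intros ? [].
    - destruct IH as [l Hl]; [intros; apply Hle; simpl; auto|].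
      assert (exists l', In y (f a l')) as [l' Hl'].
      { destruct (Hle y) as [->|H]; [simpl; auto| |apply (g_cof _ _ _ (Hf a)); auto].
        exists 0. apply (f_in_self f D Df); exact I. }
      exists (l + l'). intros z [<-|Hz]; [apply (f_mono f D Df a l')|apply (f_mono f D Df a l)];
        auto; try exact I; lia. }
  exists a, l, (map (pos l) (R ++ tl)).
  assert (Hev : forall j, ev (ix (f a)) l (map (pos l) (R ++ tl)) j = map (pos (l + j)) (R ++ tl)).
  { induction j as [|j IH]; simpl; [rewrite Nat.add_0_r; auto|].
    rewrite IH, map_map. apply map_ext_in. intros y Hy. rewrite Nat.add_succ_r. symmetry.
    apply pos_shift. apply (f_mono f D Df a l); auto; try exact I; lia. }
  split; auto. split; [|split].
  - intros j. rewrite Hev. apply Ht0. apply NNPP. intros Hn.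
    apply (Hbound _ _ Hn tl); auto. split; auto. exists a. intros y Hy.
    apply (f_mono f D Df a l); auto; try exact I; lia.
  - intros y Hy. apply Hl, in_or_app; auto.
  - exists (map (pos l) tl). split; [apply map_app|].
    intros b z Hb Hz Hzc. apply in_map_iff in Hb. destruct Hb as (y & <- & Hy).
    assert (Hzy : lt z y).
    { destruct (lt_total y z) as [H|[->|H]]; auto.
      - destruct (Htl y Hy); eauto.
      - destruct (Htl z Hy); auto. }
    assert (Hyl : In y (f a l)) by (apply Hl, in_or_app; auto).
    pose proof (f_lt_len f D Dd Df a l z y I Hz Hyl Hzy). pose proof (len_pos z l).
    unfold pos. lia.
Qed.

(** [g_free] gives a level where c0 directly follows the r_{k+1} elements of (b)_k. R precedes c0,
    hence lies in the root; the positions in q exceed that of b, the last one of the root. *)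
Lemma capture_level l p N : candidate c0 l p -> exists k q, N <= k /\
  (forall i, i < n (S k) -> realised (S k) (map (shift k i) (map (pos k) R ++ q))) /\
  (forall y, In y R -> pos k y < r (S k)) /\ (forall b, In b q -> r (S k) <= b).
Proof.
  intros Hc. destruct (g_free _ _ _ (Hf c0) Hc0) as (k0 & Hr).
  pose proof (candidate_ev c0 l p k0 Hc) as Hc'.
  destruct (Hr t0 (l + k0) (ev (ix (f c0)) l p k0) N) as (j & b & HN & Hb & E & Hl & Hall);
    [auto|lia|apply Hc'|].
  pose proof (candidate_ev _ _ _ j Hc') as Hc2.
  set (k := l + k0 + j) in *.
  destruct Hc2 as (_ & _ & HR & q & Eq & Hq). rewrite Eq in Hall.
  exists k, q. split; auto. split; [intros i Hi; apply Ht0, Hall; auto|].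
  assert (Hbin : In b (f c0 k)).
  { rewrite E. apply in_or_app; left. apply (f_in_self f D Df); exact I. }
  split.
  - intros y Hy.
    pose proof (f_lt_len f D Dd Df c0 k y c0 I (HR y Hy) (f_in_self f D Df c0 k I) (HRc y Hy)) as H.
    rewrite E, length_app in H. simpl in H. pose proof (len_pos y k). unfold pos. lia.
  - intros u Hu. pose proof (Hq u b Hu Hbin Hb). unfold pos in *. lia.
Qed.

Lemma list_bounded : forall L : list T, exists z, forall y, In y L -> lt y z.
Proof.
  intros L. destruct omega1_inhabited as [x0].
  destruct (omega1_bounded (fun i => nth i L x0)) as [z Hz]. exists z.
  intros y Hy. destruct (In_nth _ _ x0 Hy) as (i & _ & <-). auto.
Qed.

(* Up to level k the members of the i-th set have the norms [map (pos k) R ++ q], whatever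
   i is; at level k+1 the tails move to block i, which separates them. *)
Lemma captured_at k q :
  (forall i, i < n (S k) -> realised (S k) (map (shift k i) (map (pos k) R ++ q))) ->
  (forall y, In y R -> pos k y < r (S k)) -> (forall b, In b q -> r (S k) <= b) ->
  exists E, (forall i, i < n (S k) -> F (E i)) /\
    (forall i j, i < j < n (S k) -> E i <> E j) /\
    fully_captured lt m n r family (Delta_eq lt m family) (S k) E R.
Proof.
  intros Hreal HRr Hqr.
  destruct (choice _ list_bounded) as [up Hup].
  assert (Hpick : forall ic : nat * T, exists tl, fst ic < n (S k) ->
    tl <> [] /\ F (R ++ tl) /\ (forall y, In y tl -> ~ lt y (snd ic)) /\
    snapshot (S k) (map (shift k (fst ic)) (map (pos k) R ++ q)) (R ++ tl)).
  { intros [i c]. simpl. destruct (classic (i < n (S k))) as [Hi|Hi]; [|exists []; tauto].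
    destruct (Hreal i Hi c) as (tl & Htl). exists tl. auto. }
  apply choice in Hpick. destruct Hpick as [pick Hpick].
  (* [g i] bounds all tails chosen before stage i; the next tail is chosen with no element below
     it. *)
  set (g := fix g i := match i with 0 => c0 | S i => up (g i :: pick (i, g i)) end).
  set (tls := fun i => pick (i, g i)).
  assert (Hg : forall i j, i < j -> lt (g i) (g j) /\ forall y, In y (tls i) -> lt y (g j)).
  { intros i j. induction 1 as [|j Hj [IH1 IH2]].
    - split; [|intros y Hy]; apply Hup; simpl; auto.
    - assert (lt (g j) (g (S j))) by (apply Hup; simpl; auto).
      split; [|intros y Hy]; eauto. }
  assert (Htls : forall i, i < n (S k) -> tls i <> [] /\ F (R ++ tls i) /\
    (forall y, In y (tls i) -> ~ lt y (g i)) /\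
    map (pos (S k)) (R ++ tls i) = map (shift k i) (map (pos k) R ++ q)).
  { intros i Hi. destruct (Hpick (i, g i) Hi) as (H1 & H2 & H3 & _ & H4). auto. }
  assert (Hlt : forall i j, i < j < n (S k) -> forall y z, In y (tls i) -> In z (tls j) -> lt y z).
  { intros i j Hij y z Hy Hz. destruct (Htls j) as (_ & _ & H & _); [lia|].
    specialize (H z Hz). destruct (Hg i j) as [_ H1]; [lia|]. specialize (H1 y Hy).
    destruct (lt_total (g j) z) as [|[<-|]]; eauto. contradiction. }
  assert (HRt : forall i, i < n (S k) -> forall y z, In y R -> In z (tls i) -> lt y z).
  { intros i Hi y z Hy Hz. destruct (Htls i Hi) as (_ & H & _). apply Fsorted in H.
    destruct H as [_ H]. apply in_split in Hz. destruct Hz as (p1 & p2 & E). rewrite E, app_assoc in H.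
    eapply sorted_app_lt; eauto. apply in_or_app; auto. }
  assert (Htail : forall i x, In x (R ++ tls i) /\ ~ In x R -> In x (tls i)).
  { intros i x [Hx Hn]. apply in_app_or in Hx. tauto. }
  assert (Hlen : forall i, i < n (S k) -> length (R ++ tls i) = length R + length q).
  { intros i Hi. destruct (Htls i Hi) as (_ & _ & _ & H). apply (f_equal (@length nat)) in H.
    rewrite !length_map, (length_app (map _ _)), length_map in H. auto. }
  pose proof (n_ge2 k) as Hn2. pose proof (width_pos k) as Hw. pose proof (m_width k) as Hmw.
  pose proof (m_S k) as HmS.
  assert (Hpos : forall i a x, i < n (S k) -> nth_error (R ++ tls i) a = Some x ->
    exists b, nth_error (map (pos k) R ++ q) a = Some b /\ pos (S k) x = shift k i b).
  { intros i a x Hi Hx. destruct (Htls i Hi) as (_ & _ & _ & H).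
    apply (f_equal (fun l => nth_error l a)) in H. rewrite !nth_error_map, Hx in H.
    destruct (nth_error (map (pos k) R ++ q) a) as [b|]; [|discriminate].
    exists b. split; auto. inversion H; auto. }
  assert (Hroot : forall a b, nth_error (map (pos k) R ++ q) a = Some b -> a < length R -> b < r (S k)).
  { intros a b Hb Ha. rewrite nth_error_app1 in Hb by (rewrite length_map; auto).
    apply nth_error_In in Hb. apply in_map_iff in Hb. destruct Hb as (y & <- & Hy). auto. }
  assert (Hnroot : forall a b, nth_error (map (pos k) R ++ q) a = Some b -> length R <= a ->
    r (S k) <= b < m k).
  { intros a b Hb Ha. split.
    - rewrite nth_error_app2 in Hb by (rewrite length_map; auto).
      apply nth_error_In in Hb. auto.
    (* The upper bound is read off the last block, where the shifted position is still below
       m_{k+1}. *)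
    - assert (Hal : a < length (R ++ tls (n (S k) - 1))).
      { rewrite Hlen by lia. rewrite <- (length_map (pos k) R), <- length_app.
        apply nth_error_Some. congruence. }
      destruct (nth_error (R ++ tls (n (S k) - 1)) a) as [x|] eqn:Ex;
        [|apply nth_error_None in Ex; lia].
      destruct (Hpos (n (S k) - 1) a x) as (b' & Hb' & Hp); [lia|auto|].
      assert (b' = b) by congruence. subst b'.
      unfold pos, shift in Hp. pose proof (len_pos x (S k)). pose proof (g_len _ _ _ (Hf x) (S k)).
      destruct (Nat.ltb_spec b (r (S k))); [lia|]. nia. }
  (* Since r_{k+1} <= b < m_k, the position of x at level k+1 determines both its block i and its
     position b at level k. *)
  assert (Htailpos : forall i a x, i < n (S k) -> length R <= a ->
    nth_error (R ++ tls i) a = Some x ->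
    exists b, nth_error (map (pos k) R ++ q) a = Some b /\ r (S k) <= b /\
      pos (S k) x = b + i * width k /\ ix (f x) k = i /\ pos k x = b).
  { intros i a x Hi Ha Hx. destruct (Hpos i a x Hi Hx) as (b & Hb & Hp).
    destruct (Hnroot a b Hb Ha) as [H1 H2]. exists b. split; auto. split; auto.
    unfold shift in Hp. destruct (Nat.ltb_spec b (r (S k))); [lia|].
    split; auto.
    assert (Hix : ix (f x) k = i).
    { pose proof (len_pos x (S k)). unfold pos in Hp. apply (idx_eq k _ i (b - r (S k))); lia. }
    split; auto.
    rewrite pos_self_shift, Hix in Hp. unfold shift in Hp.
    destruct (Nat.ltb_spec (pos k x) (r (S k))); nia. }
  exists (fun i => R ++ tls i). split; [intros i Hi; apply Htls; auto|]. split.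
  { intros i j Hij E. apply app_inv_head in E. destruct (Htls i) as (Hne & _); [lia|].
    destruct (tls i) as [|y L] eqn:Ey; [congruence|]. apply (lt_irr y).
    apply (Hlt i j Hij); [rewrite Ey|rewrite <- E]; simpl; auto. }
  split; [lia|]. split; [|split; [auto|split]].
  - split; auto. split; [|split; [|split; [|split; [|split]]]].
    + intros i Hi. apply StronglySorted_Sorted, Fsorted, Htls; auto.
    + apply StronglySorted_Sorted, (sorted_app_l R (tls 0)), Fsorted, Htls. lia.
    + intros i Hi. rewrite !Hlen; auto; lia.
    + intros i j Hij x. rewrite !in_app_iff. split; [|tauto].
      intros [[|H1] [|H2]]; auto. destruct (lt_irr x); eauto.
    + intros i Hi y z Hy Hz. apply Htail in Hz. eauto.
    + intros i j Hij y z Hy Hz. apply Htail in Hy, Hz. eauto.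
  - intros i a x Hi Hx. pose proof (Xi_intro x k) as HX. fold (pos (S k) x) in HX.
    destruct (Nat.ltb_spec a (length R)) as [Ha|Ha].
    + destruct (Hpos i a x Hi Hx) as (b & Hb & Hp). pose proof (Hroot a b Hb Ha).
      unfold shift in Hp. destruct (Nat.ltb_spec b (r (S k))); [|lia].
      destruct (Nat.ltb_spec (pos (S k) x) (r (S k))); [auto|lia].
    + destruct (Htailpos i a x Hi Ha Hx) as (b & _ & Hb & Hp & Hix & _).
      destruct (Nat.ltb_spec (pos (S k) x) (r (S k))); [lia|]. rewrite Hix in HX. auto.
  - intros i j a x y Hij Ha Hx Hy.
    destruct (Htailpos i a x) as (b & Hb & _ & H1 & _ & H2); [lia|auto|auto|].
    destruct (Htailpos j a y) as (b' & Hb' & _ & H3 & _ & H4); [lia|auto|auto|].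
    assert (b' = b) by congruence. subst b'.
    pose proof (len_pos x k). pose proof (len_pos y k). unfold pos in *.
    apply Delta_intro; [lia|]. intros E. rewrite E in H1. nia.
Qed.

End Capture.

Lemma family_capturing :
  (forall P : nat -> list nat -> Prop, exists t, forall k p, A t k p <-> P k p) ->
  fully_capturing lt m n r family (Delta_eq lt m family).
Proof.
  intros HA F HF Hu N.
  assert (Fs : forall E, F E -> E <> [] /\ StronglySorted lt E).
  { intros E HE. destruct (HF E HE) as [H1 H2]. split; auto.
    apply Sorted_StronglySorted; auto. }
  destruct (root_exists F Fs Hu) as [R HR].
  destruct (HA (realised F R)) as [t0 Ht0].
  destruct code_dec as [dec Hdec].
  (* Each of the countably many unrealised pairs (k, p) fails above some bound; c0 is taken above
     all these bounds. *)
  assert (Hb : forall c, exists z, forall k p, dec c = k :: p -> ~ realised F R k p ->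
    forall tl, tl <> [] -> F (R ++ tl) -> (forall y, In y tl -> ~ lt y z) ->
    ~ snapshot k p (R ++ tl)).
  { intros c. destruct (dec c) as [|k p]; [exists t0; discriminate|].
    destruct (classic (realised F R k p)) as [Hr|Hr].
    - exists t0. intros k' p' E. inversion E; subst. contradiction.
    - pose proof Hr as Hr'. apply not_all_ex_not in Hr. destruct Hr as [z Hz]. exists z.
      intros k' p' E _ tl H1 H2 H3 H4. inversion E; subst. apply Hz. exists tl. auto. }
  apply choice in Hb. destruct Hb as [bd Hbd].
  destruct (omega1_bounded bd) as [z0 Hz0].
  (* Beyond the end of R the default value of [nth] is [t0], which places t0 below c0 as well. *)
  destruct (limit_above (fun i => match i with 0 => z0 | S i => nth i R t0 end)) as (c0 & Hc0 & Hlt).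
  assert (HRc : forall y, In y R -> lt y c0).
  { intros y Hy. destruct (In_nth _ _ t0 Hy) as (i & _ & <-). apply (Hlt (S i)). }
  assert (Htc : lt t0 c0).
  { specialize (Hlt (S (length R))). simpl in Hlt. rewrite nth_overflow in Hlt; auto. }
  destruct (candidate_exists F Fs R t0 c0 Ht0) as (a & l & p & Hc).
  - intros k p Hr tl H1 H2 H3. apply (Hbd (code (k :: p)) k p); auto.
    intros y Hy Hyz. apply (H3 y Hy).
    apply (lt_trans _ _ _ Hyz), (lt_trans _ _ _ (Hz0 _)), (Hlt 0).
  - destruct (HR c0) as (tl & H1 & H2 & H3 & _). eauto.
  - destruct (descend R t0 c0 Htc HRc a l p Hc) as (l' & p' & Hc').
    destruct (capture_level F R t0 c0 Ht0 Hc0 Htc HRc l' p' N Hc') as (k & q & HN & H1 & H2 & H3).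
    exists (S k). split; [lia|].
    destruct (captured_at F Fs R c0 k q H1 H2 H3) as (E & HE). exists E, R. auto.
Qed.

End Family.

End Scheme.

Theorem mainTheorem8 (T : Type) (lt : T -> T -> Prop)
  (Homega1 : is_omega1 lt) (HCH : CH T)
  (m n r : nat -> nat) (Hgood : good_type m n r) :
  exists fam : list T -> Prop,
    is_scheme lt m n r fam /\
    fully_capturing lt m n r fam (Delta_eq lt m fam).
Proof.
  destruct HCH as (h & _ & Hsurj).
  (* CH makes [h] an enumeration of the sets of natural numbers by T; [A t] consists of the
     approximations whose codes lie in the set numbered t. *)
  set (A := fun t k p => h t (code (k :: p)) = true).
  destruct (good_exists lt m n r Homega1 Hgood A) as [f Hf].
  exists (family m f). split.
  - apply (family_scheme lt m n r Homega1 Hgood A f Hf).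
  - apply (family_capturing lt m n r Homega1 Hgood A f Hf).
    intros P. set (Q := fun c => exists k p, c = code (k :: p) /\ P k p).
    destruct (Hsurj (fun c => if excluded_middle_informative (Q c) then true else false)) as [t Ht].
    exists t. intros k p. unfold A. rewrite Ht.
    destruct (excluded_middle_informative (Q (code (k :: p)))) as [Hq|Hq].
    + split; auto. intros _. destruct Hq as (k' & p' & E & HP). apply code_inj in E.
      inversion E; subst; auto.
    + split; [discriminate|]. intros HP. destruct Hq. exists k, p; auto.
Qed.
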